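(* Let $(u,m)$ be a solution of the planning problem (P) with data $d, T, V, g, m_0, m_T$. (i) Suppose that $p>0$ is such that $$\Vert \Delta V\Vert_{L^\infty([0,T]\times\mathbb{T}^d)}<\frac{2}{T^2}\,\frac1p .$$ Then there exists a positive constant $C$, depending only on the problem data $(d,T,V,g,m_0,m_T)$ and on $p$ (and not on the particular solution $(u,m)$), such that $$\max_{t\in[0,T]}\Vert m(t,\cdot)\Vert_{L^{p+1}(\mathbb{T}^d)}\le C .$$ (ii) Suppose that $d=1$, that $p\ge 2$ is such that $$\Vert \Delta V\Vert_{L^\infty([0,T]\times\mathbb{T})}<\frac{2}{T^2}\,\frac1p ,$$ and that there is a constant $k_0>0$ with $m_0(x)\ge k_0$ and $m_T(x)\ge k_0$ for all $x\in\mathbb{T}$. Then there exists a positive constant $C$, depending only on the problem data and on $p$, such that $$\max_{t\in[0,T]}\Vert m^{-1}(t,\cdot)\Vert_{L^{p-1}(\mathbb{T})}\le C .$$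
   Context: Let $d\ge1$ be an integer, $T>0$, and let $\mathbb{T}^d$ be the $d$-dimensional flat torus (unit cell, total measure $1$), with $\mathbb{T}=\mathbb{T}^1$. $D$, $\operatorname{div}$ and $\Delta$ denote the gradient, divergence and Laplacian in the space variable $x$ only. $m^{-1}$ denotes the pointwise reciprocal $1/m$. Planning problem (P). The data are: a potential $V\in C^\infty([0,T]\times\mathbb{T}^d)$; a non-decreasing function $g\in C^\infty([0,\infty))$; and probability densities $m_0,m_T\in C^\infty(\mathbb{T}^d)$ (non-negative, with integral $1$). A solution is a pair $(u,m)\in C^\infty([0,T]\times\mathbb{T}^d)\times C^\infty([0,T]\times\mathbb{T}^d)$ with $m\ge0$ and $$\begin{cases}-u_t+\dfrac{|Du|^2}{2}+V(t,x)=g(m) & \text{in }(0,T)\times\mathbb{T}^d,\\[2pt] m_t-\operatorname{div}(m\,Du)=0 & \text{in }(0,T)\times\mathbb{T}^d,\\[2pt] m(0,x)=m_0(x),\quad m(T,x)=m_T(x) & \text{in }\mathbb{T}^d.\end{cases}$$ *)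

(* Defs.v *)
From HB Require Import structures.
From mathcomp Require Import all_boot all_order all_algebra.
From mathcomp Require Import all_classical all_reals all_analysis.

Set Implicit Arguments.
Unset Strict Implicit.
Unset Printing Implicit Defensive.

Import Order.TTheory GRing.Theory Num.Theory.
Import numFieldNormedType.Exports.

Local Open Scope classical_set_scope.
Local Open Scope ring_scope.

Section smoothness.
Context {R : realType}.

(* U is always finite dimensional below; there, f is C^k as soon as its
   directional derivatives of order at most k exist and are continuous. *)
Fixpoint Ck {U : normedModType R} (k : nat) (f : U -> R) : Prop :=
  continuous f /\
  if k is k'.+1 then
    forall v : U, (forall x, derivable f x v) /\ Ck k' ('D_v f)
  else True.

Definition smooth {U : normedModType R} (f : U -> R) : Prop :=
  forall k, Ck k f.

(* Smoothness up to the boundary, i.e. f is the restriction to A of a smooth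
   function; the values of f outside A are irrelevant. *)
Definition smooth_on {U : normedModType R} (A : set U) (f : U -> R) : Prop :=
  exists F : U -> R, smooth F /\ forall x, A x -> F x = f x.

End smoothness.

(* Functions on the torus T^d = R^d / Z^d are Z^d-periodic functions on R^d. *)
Section torus.
Context {R : realType} {d : nat}.
Implicit Types (f : 'rV[R]_d -> R) (F : 'rV[R]_d -> 'rV[R]_d).

Definition periodic f : Prop :=
  forall (x : 'rV[R]_d) (i : 'I_d), f (x + delta_mx 0 i) = f x.

Definition smooth_torus f : Prop := periodic f /\ smooth f.

(* C^oo([0,T] x T^d); f t x is irrelevant when t is not in [0,T]. *)
Definition smooth_cylinder (T : R) (f : R -> 'rV[R]_d -> R) : Prop :=
  exists F : R -> 'rV[R]_d -> R,
    [/\ smooth (fun z : R * 'rV[R]_d => F z.1 z.2),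
        forall t, periodic (F t)
      & forall t x, 0 <= t <= T -> F t x = f t x].

Definition partial (i : 'I_d) f : 'rV[R]_d -> R := 'D_(delta_mx 0 i) f.

Definition gradient f (x : 'rV[R]_d) : 'rV[R]_d := \row_i partial i f x.

Definition divergence F (x : 'rV[R]_d) : R :=
  \sum_(i < d) partial i (fun y => F y 0 i) x.

Definition laplacian f : 'rV[R]_d -> R := divergence (gradient f).

(* The norm of 'rV[R]_d in the library is the sup norm. *)
Definition sqnorm (v : 'rV[R]_d) : R := \sum_(i < d) v 0 i ^+ 2.

End torus.

(* The normalized measure of T^d is the d-fold product of the Lebesgue measure
   of the unit interval, living on d-tuples, which carry the product
   sigma-algebra in the library. *)
Section torus_measure.
Context {R : realType}.

Section tuple_cons.
Context (d : nat).

Definition tuple_cons (x : measurableTypeR R * d.-tuple (measurableTypeR R)) :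
  d.+1.-tuple (measurableTypeR R) := [the _.-tuple _ of x.1 :: x.2].

Lemma measurable_tuple_cons : measurable_fun setT tuple_cons.
Proof. by apply: measurable_cons; [exact: measurable_fst|exact: measurable_snd]. Qed.

HB.instance Definition _ :=
  isMeasurableFun.Build _ _ _ _ tuple_cons measurable_tuple_cons.

End tuple_cons.

Fixpoint torus_measure (d : nat) :
    probability (d.-tuple (measurableTypeR R)) R :=
  match d with
  | 0 => dirac [tuple]
  | d'.+1 =>
      distribution (uniform_prob (@ltr01 R) \x torus_measure d')%E
        (tuple_cons (d := d') : {mfun _ >-> _})
  end.

Definition point {d : nat} (x : d.-tuple R) : 'rV[R]_d := \row_i tnth x i.

Definition time_measure (T : R) : {measure set (measurableTypeR R) -> \bar R} :=
  mrestr lebesgue_measure (measurable_itv `[0, T]).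

Definition cylinder_measure (d : nat) (T : R) :
    {measure set (measurableTypeR R * d.-tuple (measurableTypeR R)) -> \bar R} :=
  (time_measure T \x torus_measure d)%E.

Local Open Scope ereal_scope.

Definition torus_Lnorm {d : nat} (q : R) (f : 'rV[R]_d -> \bar R) : \bar R :=
  'N[torus_measure d]_(q%:E)[(fun x => f (point x))].

Definition cylinder_Linfty {d : nat} (T : R) (f : R -> 'rV[R]_d -> R) : \bar R :=
  'N[cylinder_measure d T]_(+oo)[(fun z => (f z.1 (point z.2))%:E)].

(* max over t in [0,T] of the L^q norms of f(t,.), as a supremum in \bar R *)
Definition max_Lnorm {d : nat} (T q : R) (f : R -> 'rV[R]_d -> \bar R) : \bar R :=
  ereal_sup [set torus_Lnorm q (f t) | t in `[0%R, T]%classic].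

End torus_measure.

Section planning_problem.
Context {R : realType} {d : nat}.

Definition smooth_density (f : 'rV[R]_d -> R) : Prop :=
  [/\ smooth_torus f, forall x, 0 <= f x
    & (\int[torus_measure d]_x (f (point x))%:E = 1)%E].

Definition planning_data (T : R) (V : R -> 'rV[R]_d -> R) (g : R -> R)
    (m0 mT : 'rV[R]_d -> R) : Prop :=
  [/\ smooth_cylinder T V,
      smooth_on [set y : R | 0 <= y] g /\ {in `[0, +oo[ &, {homo g : x y / x <= y}},
      smooth_density m0
    & smooth_density mT].

Definition planning_solution (T : R) (V : R -> 'rV[R]_d -> R) (g : R -> R)
    (m0 mT : 'rV[R]_d -> R) (u m : R -> 'rV[R]_d -> R) : Prop :=
  [/\ smooth_cylinder T u /\ smooth_cylinder T m,
      forall t x, 0 <= t <= T -> 0 <= m t x,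
      forall t x, 0 < t < T ->
        - derive1 (fun s => u s x) t + sqnorm (gradient (u t) x) / 2 + V t x
          = g (m t x),
      forall t x, 0 < t < T ->
        derive1 (fun s => m s x) t
          - divergence (fun y => m t y *: gradient (u t) y) x = 0
    & forall x, m 0 x = m0 x /\ m T x = mT x].

End planning_problem.

(* Main.v *)
(* Along a solution, the internal energy phi(t) of density U satisfies
     phi' = \int P(m) Lap u,   P(y) = y U'(y) - U(y),
     phi'' = \int (m P'(m) - P(m)) (Lap u)^2 + P(m) |D^2 u|^2
             + P(m) Lap V + P'(m) g'(m) |Dm|^2.
   For U(y) = y (y + 1)^p, and in dimension one for U(y) = (y + e)^(1 - p), the
   terms without V are nonnegative and |P| <= p U, so that phi'' >= - k phi with
   k = p ||Lap V||. Since k T^2 / 2 < 1, this bounds phi by its values at the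
   endpoints, which depend only on m0 and mT. The second energy is bounded
   uniformly in e, and e tends to 0 by monotone convergence. *)
Require Import Defs.
From mathcomp Require Import all_boot all_order all_algebra.
From mathcomp Require Import all_classical all_reals all_analysis.
From mathcomp Require Import measurable_realfun ess_sup_inf.
From mathcomp Require Import ring lra.
Import Order.TTheory GRing.Theory Num.Theory.
Import numFieldNormedType.Exports.
Local Open Scope classical_set_scope.
Local Open Scope ring_scope.

Set Implicit Arguments.
Unset Strict Implicit.
Unset Printing Implicit Defensive.

(** * Directional derivatives of smooth functions *)

(** Solutions are smooth only up to the boundary of [0,T], and the equations hold only for 0 < t <
    T. The argument therefore runs on smooth periodic extensions. Their space derivatives are those
    of the solution on all of [0,T], but the energy is differentiated in time only inside, and its
    continuity at the end times needs a separate argument.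

    The formula for phi'' contains the time derivative of Lap u, which the first equation expresses
    through D^2 u, V and g(m). This brings in Du . D Lap u and Lap g(m), two terms without sign.
    They are removed by integrating by parts with a single vector field. Since g is monotone, what
    is left of Lap g(m) has a good sign.

    The sign of P decides the admissible dimension. For growing powers P >= 0, so (Lap u)^2 and |D^2
    u|^2 may be treated separately. For negative powers P < 0, and the two terms help only when they
    coincide, that is when d = 1: then P cancels and m P'(m) (Lap u)^2 remains. The shift by e is
    there because no positive lower bound for m at intermediate times is known beforehand. *)

Section directional_derivatives.
Context {R : realType} {U : normedModType R}.
Implicit Types (f g : U -> R) (x v w : U).

(** The two difference quotients are the same function of the increment. Together with the converse
    [line_is_derive], this carries the one-variable chain rule and mean value theorem over to
    directional derivatives, without Frechet differentiability. *)
Lemma is_derive_line f x v (s df : R) :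
  is_derive (s *: v + x) v f df -> is_derive s 1 (fun h : R => f (h *: v + x)) df.
Proof.
have E : (fun h : R => h^-1 *: ((f \o shift (s *: v + x)) (h *: v) - f (s *: v + x)))
  = (fun h : R => h^-1 *: (((fun h : R => f (h *: v + x)) \o shift s) (h *: (1 : R))
       - f (s *: v + x))).
  by apply/funext => h /=; rewrite [_%:A]mulr1 scalerDl addrA.
by move=> [+ <-]; rewrite /derivable E => ?; split=> //; rewrite /derive E.
Qed.

Lemma line_is_derive f x v (s df : R) :
  is_derive s 1 (fun h : R => f (h *: v + x)) df -> is_derive (s *: v + x) v f df.
Proof.
have E : (fun h : R => h^-1 *: ((f \o shift (s *: v + x)) (h *: v) - f (s *: v + x)))
  = (fun h : R => h^-1 *: (((fun h : R => f (h *: v + x)) \o shift s) (h *: (1 : R))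
       - f (s *: v + x))).
  by apply/funext => h /=; rewrite [_%:A]mulr1 scalerDl addrA.
by move=> [+ <-]; rewrite /derivable -E => ?; split=> //; rewrite /derive E.
Qed.

Lemma is_derive_comp1 (G : R -> R) f x v (dG df : R) :
  is_derive (f x) 1 G dG -> is_derive x v f df ->
  is_derive x v (fun y => G (f y)) (dG * df).
Proof.
move=> hG hf; have x0 : x = 0 *: v + x by rewrite scale0r add0r.
rewrite x0; apply: line_is_derive.
rewrite x0 in hG hf.
exact: (@is_derive1_comp _ G (fun h : R => f (h *: v + x)) 0 _ _ hG (is_derive_line hf)).
Qed.

Lemma smooth_continuous f : smooth f -> continuous f.
Proof. by move=> /(_ 0%N) []. Qed.

Lemma smooth_derivable f v x : smooth f -> derivable f x v.
Proof. by move=> /(_ 1%N) [_] /(_ v) []. Qed.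

Lemma smooth_derive f v : smooth f -> smooth ('D_v f).
Proof. by move=> sf k; have [_] := sf k.+1; move=> /(_ v) []. Qed.

Lemma CkS k f : Ck k.+1 f -> Ck k f.
Proof.
elim: k f => [f [cf _]//|k IH f [cf Hf]]; split=> // v.
by have [df Cf] := Hf v; split=> //; exact: IH.
Qed.

Lemma CkD k f g : Ck k f -> Ck k g -> Ck k (fun x => f x + g x).
Proof.
elim: k f g => [f g [cf _] [cg _]|k IH f g [cf Hf] [cg Hg]].
  by split=> // x; apply: (@continuousD _ _ _ f g); [exact: cf|exact: cg].
split=> [x|v]; first by apply: (@continuousD _ _ _ f g); [exact: cf|exact: cg].
have [df Cf] := Hf v; have [dg Cg] := Hg v; split=> [x|]; first exact: derivableD.
rewrite (_ : 'D_v _ = fun x => 'D_v f x + 'D_v g x); first exact: IH.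
by apply/funext => x; rewrite -deriveD.
Qed.

Lemma CkM k f g : Ck k f -> Ck k g -> Ck k (fun x => f x * g x).
Proof.
elim: k f g => [f g [cf _] [cg _]|k IH f g Hf0 Hg0].
  by split=> // x; apply: (@continuousM _ _ f g); [exact: cf|exact: cg].
have [cf Hf] := Hf0; have [cg Hg] := Hg0.
split=> [x|v]; first by apply: (@continuousM _ _ f g); [exact: cf|exact: cg].
have [df Cf] := Hf v; have [dg Cg] := Hg v; split=> [x|]; first exact: derivableM.
rewrite (_ : 'D_v _ = fun x => f x * 'D_v g x + g x * 'D_v f x).
  by apply: CkD; apply: IH => //; exact: CkS.
by apply/funext => x; rewrite (@deriveM _ _ f g).
Qed.

Lemma Ck_cst k (c : R) : Ck k (fun _ : U => c).
Proof.
elim: k c => [|k IH] c; first by split=> // x; exact: cst_continuous.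
split=> [x|v]; first exact: cst_continuous.
split=> [x|]; first exact: derivable_cst.
rewrite (_ : 'D_v _ = fun=> 0) //.
by apply/funext => x; exact: derive_cst.
Qed.

Lemma smooth_cst (c : R) : smooth (fun _ : U => c).
Proof. by move=> k; exact: Ck_cst. Qed.

Lemma smoothD f g : smooth f -> smooth g -> smooth (fun x => f x + g x).
Proof. by move=> sf sg k; exact: CkD. Qed.

Lemma smoothM f g : smooth f -> smooth g -> smooth (fun x => f x * g x).
Proof. by move=> sf sg k; exact: CkM. Qed.

Lemma smoothN f : smooth f -> smooth (fun x => - f x).
Proof.
move=> sf; under eq_fun do rewrite -mulN1r.
by apply: smoothM => //; exact: smooth_cst.
Qed.

Lemma smooth_sum (I : Type) (r : seq I) (F : I -> U -> R) :
  (forall i, smooth (F i)) -> smooth (fun x => \sum_(i <- r) F i x).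
Proof.
move=> sF; elim: r => [|i r IH].
  by under eq_fun do rewrite big_nil; exact: smooth_cst.
by under eq_fun do rewrite big_cons; exact: smoothD.
Qed.

End directional_derivatives.

(** * Symmetry of second directional derivatives *)

Section schwarz.
Context {R : realType} {U : normedModType R}.
Implicit Types (f : U -> R) (x v w : U).

(* Both mixed derivatives are limits of the same symmetric second difference:
   by the mean value theorem applied in v and then in w, it is s^2 times
   a mixed derivative at a nearby point. *)
Lemma second_difference_mean f x v w (s : R) : smooth f -> 0 < s ->
  exists a b : R, [/\ 0 < a < s, 0 < b < s &
   f (s *: w + (s *: v + x)) - f (s *: v + x) - f (s *: w + x) + f x =
   s ^+ 2 * 'D_w ('D_v f) (b *: w + (a *: v + x))].
Proof.
move=> sf s0.
pose h a := f (s *: w + (a *: v + x)) - f (a *: v + x).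
pose dh a := 'D_v f (s *: w + (a *: v + x)) - 'D_v f (a *: v + x).
have dhE (a : R) : is_derive a 1 h (dh a).
  apply: is_deriveB.
    under eq_fun do rewrite addrCA.
    rewrite addrCA; apply: (@is_derive_line _ _ f (s *: w + x)).
    by apply: derivableP; exact: smooth_derivable.
  by apply: (@is_derive_line _ _ f x); apply: derivableP; exact: smooth_derivable.
have ch : {within `[0, s], continuous h}.
  by apply: derivable_within_continuous => a _; exact: ex_derive.
have [a /[!in_itv]/= a01 ha] := MVT s0 (fun a _ => dhE a) ch.
pose k b := 'D_v f (b *: w + (a *: v + x)).
have dkE (b : R) : is_derive b 1 k ('D_w ('D_v f) (b *: w + (a *: v + x))).
  apply: (@is_derive_line _ _ ('D_v f)); apply: derivableP; apply: smooth_derivable.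
  exact: smooth_derive.
have ck : {within `[0, s], continuous k}.
  by apply: derivable_within_continuous => b _; exact: ex_derive.
have [b /[!in_itv]/= b01 kb] := MVT s0 (fun b _ => dkE b) ck.
exists a, b; split=> //.
move: ha; rewrite /h /dh !scale0r !add0r.
move: kb; rewrite /k scale0r add0r => ->.
rewrite subr0 => E.
rewrite expr2 [RHS]mulrC mulrA -E; ring.
Qed.


Lemma derive_comm f x v w : smooth f -> 'D_w ('D_v f) x = 'D_v ('D_w f) x.
Proof.
move=> sf; apply/eqP/negPn/negP => pq.
set p := 'D_w ('D_v f) in pq *; set q := 'D_v ('D_w f) in pq *.
have cp : continuous p by apply/smooth_continuous/smooth_derive/smooth_derive.
have cq : continuous q by apply/smooth_continuous/smooth_derive/smooth_derive.
(* Half of the supposed gap. Near x both mixed derivatives move by less than [e], and the second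
   difference makes them agree at two nearby points, so the gap would be smaller than itself. *)
pose e := `|p x - q x| / 2.
have e0 : 0 < e by rewrite divr_gt0 ?normr_gt0 ?subr_eq0.
have /nbhs_ballP[r /= r0 xr] :
    \forall y \near x, `|p x - p y| < e /\ `|q x - q y| < e.
  have /cvgrPdist_lt/(_ e e0) Hp := cp x.
  have /cvgrPdist_lt/(_ e e0) Hq := cq x.
  exact: (filterI Hp Hq).
(* With this side the mean value points stay in the ball of radius [r]; the summand 1 covers v = w =
   0. *)
pose s := r / (`|v| + `|w| + 1).
have n0 : 0 < `|v| + `|w| + 1 by rewrite ltr_wpDl// addr_ge0.
have s0 : 0 < s by rewrite divr_gt0.
have near_x a b v' w' : 0 < a < s -> 0 < b < s -> `|v'| + `|w'| = `|v| + `|w| ->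
    ball x r (b *: w' + (a *: v' + x)).
  move=> /andP[a0 as_] /andP[b0 bs] vw; rewrite -ball_normE /=.
  rewrite addrA opprD addrCA subrr addr0 normrN (le_lt_trans (ler_normD _ _))//.
  rewrite !normrZ !gtr0_norm//.
  apply: (@le_lt_trans _ _ (s * (`|v| + `|w|))).
    by rewrite -vw mulrDr addrC lerD// ler_wpM2r// ltW.
  by rewrite /s mulrAC ltr_pdivrMr// ltr_pM2l// ltrDl.
have [a [b [a0 b0 E1]]] := second_difference_mean x v w sf s0.
have [a' [b' [a'0 b'0 E2]]] := second_difference_mean x w v sf s0.
have [H1 _] := xr _ (near_x _ _ v w a0 b0 erefl).
have [_ H2] := xr _ (near_x _ _ w v a'0 b'0 (addrC _ _)).
have E : p (b *: w + (a *: v + x)) = q (b' *: v + (a' *: w + x)).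
  have : s ^+ 2 * p (b *: w + (a *: v + x)) = s ^+ 2 * q (b' *: v + (a' *: w + x)).
    apply: etrans (esym E1) _; apply: etrans _ E2.
    have -> : s *: w + (s *: v + x) = s *: v + (s *: w + x) by exact: addrCA.
    by rewrite [X in X + f x]addrAC.
  by apply: mulfI; exact: (lt0r_neq0 (exprn_gt0 2 s0)).
move: H1 H2; rewrite E /e; move: (p x) (q x) (q _) => A B C H1 H2.
have := ler_distD C A B; rewrite (distrC C B) leNgt => /negP; apply.
by rewrite [ltRHS]splitr ltrD.
Qed.

End schwarz.

Section slices.
Context {R : realType} {U : normedModType R}.
Implicit Types (F : R * U -> R) (x v : U).

Lemma is_derive_slice_space F (t : R) x v (df : R) :
  is_derive (t, x) (0, v) F df -> is_derive x v (fun y => F (t, y)) df.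
Proof.
have e h : h *: (0 : R, v) + (t, x) = (t, h *: v + x).
  by rewrite [LHS]surjective_pairing /= scaler0 add0r.
move=> H; have x0 : x = 0 *: v + x by rewrite scale0r add0r.
rewrite x0; apply: line_is_derive.
under eq_fun do rewrite -e.
by apply: is_derive_line; rewrite scale0r add0r.
Qed.

Lemma is_derive_slice_time F (t : R) x (df : R) :
  is_derive (t, x) (1, 0 : U) F df -> is_derive t 1 (fun s => F (s, x)) df.
Proof.
have e h : h *: (1 : R, 0 : U) + (0, x) = (h, x).
  by rewrite [LHS]surjective_pairing /= scaler0 add0r addr0 [_ *: _]mulr1.
move=> H; under eq_fun do rewrite -e.
by apply: is_derive_line; rewrite e.
Qed.

Lemma continuous_pairr (t : R) : continuous (fun x : U => (t, x)).
Proof.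
by move=> x; apply: (@cvg_pair _ _ _ _ (nbhs t) (nbhs x)); [exact: cvg_cst|exact: cvg_id].
Qed.

Lemma continuous_pairl (x : U) : continuous (fun t : R => (t, x)).
Proof.
by move=> t; apply: (@cvg_pair _ _ _ _ (nbhs t) (nbhs x)); [exact: cvg_id|exact: cvg_cst].
Qed.

Lemma continuous_slice F (t : R) : continuous F -> continuous (fun x => F (t, x)).
Proof.
move=> cF x; apply: (@continuous_comp _ _ _ (fun x => (t, x)) F); last exact: cF.
exact: continuous_pairr.
Qed.

End slices.

(** * Integration on the torus *)

Section torus_functions.
Context {R : realType} {d : nat}.
Implicit Types (f g : 'rV[R]_d -> R) (x : 'rV[R]_d).

Lemma rV_ballP x y (e : R) : 0 < e ->
  ball x e y <-> forall i, `|x 0 i - y 0 i| < e.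
Proof.
move=> e0; split=> [[_ H] i|H]; first by have := H 0 i; rewrite -ball_normE.
by split=> // i j; rewrite (ord1 i) -ball_normE /=; exact: H.
Qed.

Lemma measurable_box (c : 'I_d -> R) (r : R) :
  measurable [set x : d.-tuple (measurableTypeR R) | forall i, `|c i - tnth x i| < r].
Proof.
rewrite (_ : [set _ | _] = \bigcap_(i in setT)
    (fun x : d.-tuple (measurableTypeR R) => tnth x i) @^-1` ball (c i) r); last first.
  apply/seteqP; split=> [x H i _|x H i]; first by rewrite -ball_normE; exact: H.
  by have := H i I; rewrite -ball_normE.
apply: fin_bigcap_measurable; first exact: finite_finset.
move=> i _; rewrite -[X in measurable X]setTI; apply: (measurable_tnth i) => //.
apply: open_measurable; exact: ball_open.
Qed.

(** The sigma-algebra on tuples is the product one, defined without the topology of row vectors. The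
    two are linked by writing an open set as a countable union of the sup-norm boxes with rational
    centre and radius 1/(n+1) that it contains. *)
Lemma measurable_point (A : set 'rV[R]_d) : open A ->
  measurable (@Defs.point R d @^-1` A : set (d.-tuple (measurableTypeR R))).
Proof.
move=> oA.
pose box (q : 'rV[rat]_d * nat) : set (d.-tuple (measurableTypeR R)) :=
  [set x | forall i, `|ratr (q.1 0 i) - tnth x i| < (q.2.+1%:R : R)^-1].
pose F n := if unpickle n is Some q then box q else set0.
rewrite (_ : _ @^-1` _ = \bigcup_(n in [set n | F n `<=` @Defs.point R d @^-1` A]) F n).
  apply: bigcup_measurable => n _; rewrite /F; case: unpickle => [q|//].
  exact: measurable_box.
apply/seteqP; split=> [x /= Ax|x [n /= FA Fx]]; last exact: FA.
have /nbhs_ballP[e /= e0 xe] : nbhs (Defs.point x) A by exact: open_nbhs_nbhs.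
(* Radius below e/2: the box around a rational point within that distance of x contains x and stays
   within e of it. *)
pose n := Num.truncn (2 / e).
have n0 : 0 < (n.+1%:R : R)^-1 by rewrite invr_gt0.
have ne : (n.+1%:R : R)^-1 < e / 2.
  by rewrite -[ltRHS]invrK ltf_pV2 ?posrE ?invr_gt0 ?divr_gt0// invf_div truncnS_gt.
have /choice[q hq] : forall i, exists q : rat, `|ratr q - tnth x i| < (n.+1%:R : R)^-1.
  move=> i; have [|q] := @rat_in_itvoo R (tnth x i - n.+1%:R^-1) (tnth x i + n.+1%:R^-1).
    by rewrite ltrD2l gtrN.
  by rewrite in_itv /= => /andP[h1 h2]; exists q; rewrite ltr_distl h1 h2.
have FE : F (pickle (\row_i q i, n)) = box (\row_i q i, n) by rewrite /F pickleK.
exists (pickle (\row_i q i, n)) => /=; rewrite FE; last by move=> i /=; rewrite mxE.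
move=> y /= hy; apply: xe; apply/rV_ballP => // i; rewrite !mxE.
have := hy i; rewrite /= mxE => hyi.
have := hq i; rewrite distrC => hqi.
apply: (le_lt_trans (ler_distD (ratr (q i)) _ _)).
by rewrite (splitr e) ltrD ?(lt_trans _ ne).
Qed.

Lemma measurable_fun_point f : continuous f ->
  measurable_fun setT (fun x : d.-tuple (measurableTypeR R) => f (Defs.point x)).
Proof.
move=> cf; apply: (measurability _ (RGenOpens.measurableE R)).
move=> _ [_ [a [b ->] <-]]; rewrite setTI.
apply: (@measurable_point (f @^-1` `]a, b[)).
by move/continuousP: cf; apply; exact: interval_open.
Qed.

Lemma periodic_int f x (i : 'I_d) (z : int) : Defs.periodic f ->
  f (x + z%:~R *: delta_mx 0 i) = f x.
Proof.
move=> pf; have pn (n : nat) y : f (y + n%:R *: delta_mx 0 i) = f y.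
  elim: n y => [|n IH] y; first by rewrite scale0r addr0.
  by rewrite -natr1 scalerDl scale1r addrA pf IH.
case: z => n; first exact: pn.
rewrite NegzE mulrNz scaleNr -[in RHS](subrK (n.+1%:R *: delta_mx 0 i) x).
by rewrite pn.
Qed.

Definition fractional_part x : 'rV[R]_d := \row_i (x 0 i - (Num.floor (x 0 i))%:~R).

Lemma fractional_part_itv x i : fractional_part x 0 i \in `[0, 1[.
Proof.
rewrite mxE in_itv /= subr_ge0 ltrBlDl.
by have := floor_itv (x 0 i); rewrite intrD mulr1z.
Qed.

(** The integer parts are removed one coordinate at a time, by induction on the list of indices with
    the point generalized. *)
Lemma periodic_fractional_part f x : Defs.periodic f -> f (fractional_part x) = f x.
Proof.
move=> pf; pose z i := - Num.floor (x 0 i).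
have -> : fractional_part x = x + \sum_i (z i)%:~R *: delta_mx 0 i.
  apply/rowP => j; rewrite !mxE summxE (bigD1 j)//= big1.
    by rewrite !mxE !eqxx mulr1 addr0 /z mulrNz.
  by move=> i ij; rewrite !mxE eqxx /= eq_sym (negbTE ij) mulr0.
elim: (index_enum _) (x) => [|i r IH] y; first by rewrite big_nil addr0.
by rewrite big_cons addrA IH periodic_int.
Qed.

Definition unit_cube : set 'rV[R]_d := [set x | forall i, `[0, 1]%classic (x 0 i)].

Lemma unit_cube_compact : compact unit_cube.
Proof. exact: (@rV_compact R d (fun=> `[0, 1]%classic) (fun=> @segment_compact R 0 1)). Qed.

(** Periodicity brings every point into the unit cube, and the product of [a,b] with the cube is
    compact. The bound is uniform in time, which later gives the domination needed to differentiate
    under the integral. *)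
Lemma periodic_bounded (F : R -> 'rV[R]_d -> R) (a b : R) :
  (forall t, a <= t <= b -> Defs.periodic (F t)) ->
  (forall t x, a <= t <= b -> {for (t, x), continuous (fun z => F z.1 z.2)}) ->
  exists2 M : R, 0 <= M & forall t x, a <= t <= b -> `|F t x| <= M.
Proof.
move=> pF cF.
have cpt : compact (`[a, b]%classic `*` unit_cube).
  by apply: compact_setX; [exact: segment_compact|exact: unit_cube_compact].
have cFw : {within `[a, b]%classic `*` unit_cube,
    continuous (fun z : R * 'rV[R]_d => F z.1 z.2)}.
  apply: continuous_in_subspaceT => -[t x] /[!inE] -[/= + _].
  by rewrite in_itv => /cF; exact.
have /compact_bounded[M [_ HM]] := continuous_compact cFw cpt.
exists (`|M| + 1); first by rewrite addr_ge0.
move=> t x tab; rewrite -(periodic_fractional_part _ (pF t tab)).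
apply: HM; first by rewrite ltr_pwDr// ler_norm.
exists (t, fractional_part x) => //; split; first by rewrite /= in_itv.
by move=> i; have := fractional_part_itv x i; rewrite /= !in_itv /= => /andP[-> /ltW].
Qed.

Definition torus_continuous f := Defs.periodic f /\ continuous f.

Lemma torus_continuous_bounded f : torus_continuous f ->
  exists2 M : R, 0 <= M & forall x, `|f x| <= M.
Proof.
move=> [pf cf]; have [//|t x _|M M0 H] := @periodic_bounded (fun=> f) 0 0.
  by apply: (@continuous_comp _ _ _ snd f); [exact: cvg_snd|exact: cf].
by exists M => // x; apply: (H 0); rewrite lexx.
Qed.

Lemma torus_continuousD f g : torus_continuous f -> torus_continuous g ->
  torus_continuous (fun x => f x + g x).
Proof.
move=> [pf cf] [pg cg]; split=> [x i|x]; first by rewrite pf pg.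
by apply: (@continuousD _ _ _ f g); [exact: cf|exact: cg].
Qed.

Lemma torus_continuousM f g : torus_continuous f -> torus_continuous g ->
  torus_continuous (fun x => f x * g x).
Proof.
move=> [pf cf] [pg cg]; split=> [x i|x]; first by rewrite pf pg.
by apply: (@continuousM _ _ f g); [exact: cf|exact: cg].
Qed.

Lemma torus_continuous_cst (c : R) : torus_continuous (fun=> c).
Proof. by split=> // x; exact: cst_continuous. Qed.

Lemma torus_continuousN f : torus_continuous f -> torus_continuous (fun x => - f x).
Proof.
by move=> [pf cf]; split=> [x i|x]; [rewrite pf|exact/continuousN/cf].
Qed.

Lemma torus_continuous_sum (I : Type) (r : seq I) (F : I -> 'rV[R]_d -> R) :
  (forall i, torus_continuous (F i)) ->
  torus_continuous (fun x => \sum_(i <- r) F i x).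
Proof.
move=> cF; elim: r => [|i r IH].
  by under eq_fun do rewrite big_nil; exact: torus_continuous_cst.
by under eq_fun do rewrite big_cons; exact: torus_continuousD.
Qed.

Lemma torus_continuous_comp (G : R -> R) f : torus_continuous f ->
  (forall x, {for f x, continuous G}) -> torus_continuous (fun x => G (f x)).
Proof.
move=> [pf cf] cG; split=> [x i|x]; first by rewrite pf.
by apply: continuous_comp; [exact: cf|exact: cG].
Qed.

Lemma torus_integrable f : torus_continuous f ->
  (torus_measure d).-integrable setT (EFin \o (fun y => f (Defs.point y))).
Proof.
move=> tf; have [M M0 HM] := torus_continuous_bounded tf.
apply: measurable_bounded_integrable => //.
- exact: fin_num_fun_lty (fin_num_measure _).
- by apply: measurable_fun_point; case: tf.
- exists M; split; first exact: num_real.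
  by move=> y My x _; rewrite /= (le_trans (HM _))// ltW.
Qed.

Definition torus_integral f : R := (\int[torus_measure d]_y f (Defs.point y))%R.

Lemma torus_integral_EFin f : torus_continuous f ->
  (\int[torus_measure d]_y (f (Defs.point y))%:E = (torus_integral f)%:E)%E.
Proof.
move=> tf; rewrite /torus_integral /Rintegral fineK//.
exact: (integrable_fin_num _ (torus_integrable tf)).
Qed.

Lemma eq_torus_integral f g : f =1 g -> torus_integral f = torus_integral g.
Proof. by move=> /funext ->. Qed.

Lemma torus_integralD f g : torus_continuous f -> torus_continuous g ->
  torus_integral (fun x => f x + g x) = torus_integral f + torus_integral g.
Proof. by move=> tf tg; apply: RintegralD => //; exact: torus_integrable. Qed.

Lemma torus_integralB f g : torus_continuous f -> torus_continuous g ->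
  torus_integral (fun x => f x - g x) = torus_integral f - torus_integral g.
Proof. by move=> tf tg; apply: RintegralB => //; exact: torus_integrable. Qed.

Lemma torus_integralZl f c : torus_continuous f ->
  torus_integral (fun x => c * f x) = c * torus_integral f.
Proof. by move=> tf; apply: RintegralZl => //; exact: torus_integrable. Qed.

Lemma torus_integral_cst c : torus_integral (fun=> c) = c.
Proof.
by rewrite /torus_integral Rintegral_cst//= probability_setT mulr1.
Qed.

Lemma torus_integralN f : torus_continuous f ->
  torus_integral (fun x => - f x) = - torus_integral f.
Proof.
move=> tf; rewrite -mulN1r -torus_integralZl//.
by apply: eq_torus_integral => x; rewrite mulN1r.
Qed.

Lemma torus_integral_sum (I : Type) (r : seq I) (F : I -> 'rV[R]_d -> R) :
  (forall i, torus_continuous (F i)) ->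
  torus_integral (fun x => \sum_(i <- r) F i x) = \sum_(i <- r) torus_integral (F i).
Proof.
move=> cF; elim: r => [|i r IH].
  rewrite big_nil -[RHS](torus_integral_cst 0); apply: eq_torus_integral => x.
  by rewrite big_nil.
rewrite big_cons -IH -torus_integralD//; last exact: torus_continuous_sum.
by apply: eq_torus_integral => x; rewrite big_cons.
Qed.

Lemma le_torus_integral f g : torus_continuous f -> torus_continuous g ->
  (forall x, f x <= g x) -> torus_integral f <= torus_integral g.
Proof.
by move=> tf tg fg; apply: le_Rintegral => //; exact: torus_integrable.
Qed.

End torus_functions.

(** * Fubini on the torus, and vanishing integrals of derivatives *)

Section integration_by_parts.
Context {R : realType}.

Lemma integral_uniform_signed (f : R -> \bar R) : measurable_fun setT f ->
  (\int[uniform_prob (@ltr01 R)]_x f x =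
   \int[lebesgue_measure]_(x in `[0%R, 1%R]) f x)%E.
Proof.
move=> mf; rewrite integralE (integral_uniform ltr01 (measurable_funepos mf))//.
rewrite (integral_uniform ltr01 (measurable_funeneg mf))//.
by rewrite subr0 invr1 !mul1e -integralE.
Qed.

(** The counterpart of [tuple_cons] for row vectors, which lets integrals follow the recursion on
    the dimension in [torus_measure]. *)
Definition row_cons d (s : R) (y : 'rV[R]_d) : 'rV[R]_d.+1 :=
  \row_k (if unlift ord0 k is Some j then y 0 j else s).

Lemma row_cons_head d (h s : R) (y : 'rV[R]_d) :
  row_cons (h + s) y = h *: delta_mx 0 ord0 + row_cons s y.
Proof.
apply/rowP => k; rewrite !mxE eqxx /=; case: unliftP => [j ->|->].
  by rewrite eq_sym (negbTE (neq_lift _ _)) mulr0 add0r.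
by rewrite eqxx mulr1.
Qed.

Lemma row_cons_tail d (h s : R) (y : 'rV[R]_d) j :
  row_cons s (h *: delta_mx 0 j + y) = h *: delta_mx 0 (lift ord0 j) + row_cons s y.
Proof.
apply/rowP => k; rewrite !mxE !eqxx /=; case: unliftP => [i ->|->].
  by rewrite !mxE eqxx (inj_eq lift_inj).
by rewrite (negbTE (neq_lift _ _)) mulr0 add0r.
Qed.

Lemma continuous_row_cons d s : continuous (@row_cons d s).
Proof.
move=> y A /nbhs_ballP[e /= e0 yA]; apply/nbhs_ballP; exists e => // z.
move=> /(rV_ballP _ _ e0) yz; apply: yA; apply/(rV_ballP _ _ e0) => k; rewrite !mxE.
by case: unliftP => [j _|_]; rewrite ?yz// subrr normr0.
Qed.

Lemma continuous_row_cons_head d (y : 'rV[R]_d) : continuous (fun s => row_cons s y).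
Proof.
move=> s A /nbhs_ballP[e /= e0 sA]; apply/nbhs_ballP; exists e => // z.
rewrite -ball_normE /= => sz; apply: sA; apply/(rV_ballP _ _ e0) => k; rewrite !mxE.
by case: unliftP => [j _|//]; rewrite subrr normr0.
Qed.

Lemma point_cons d (s : R) (y : d.-tuple R) :
  Defs.point (tuple_cons (s, y)) = row_cons s (Defs.point y).
Proof.
apply/rowP => k; rewrite !mxE; case: unliftP => [j ->|->].
  by rewrite mxE tnthS.
by rewrite tnth0.
Qed.

Lemma torus_continuous_cons d (f : 'rV[R]_d.+1 -> R) s : torus_continuous f ->
  torus_continuous (fun y => f (row_cons s y)).
Proof.
move=> [pf cf]; split=> [y j|y]; last first.
  by apply: continuous_comp; [exact: continuous_row_cons|exact: cf].
rewrite -[delta_mx 0 j]scale1r addrC row_cons_tail scale1r addrC; exact: pf.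
Qed.

Section fubini.
Context (d : nat) (f : 'rV[R]_d.+1 -> R) (tf : torus_continuous f).

Let h (z : measurableTypeR R * d.-tuple (measurableTypeR R)) : \bar R :=
  (f (row_cons z.1 (Defs.point z.2)))%:E.

Let hE : h = (EFin \o (fun y => f (Defs.point y))) \o (@tuple_cons R d).
Proof. by apply/funext => -[s y]; rewrite /h /= -point_cons. Qed.

Let measurable_h : measurable_fun setT h.
Proof.
rewrite hE; apply: measurableT_comp; last exact: measurable_tuple_cons.
by apply/measurable_EFinP; apply: measurable_fun_point; case: tf.
Qed.

Let integrable_h : (uniform_prob (@ltr01 R) \x torus_measure d)%E.-integrable setT h.
Proof.
have [M M0 HM] := torus_continuous_bounded tf.
apply: measurable_bounded_integrable => //.
- have E := @product_measure1E _ _ _ _ R (uniform_prob (@ltr01 R))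
    (torus_measure d) _ _ measurableT measurableT.
  rewrite setXTT in E; apply: (@le_lt_trans _ _ (1%R%:E : \bar R)); last exact: ltry.
  have E1 := @probability_setT _ _ R (uniform_prob (@ltr01 R)).
  have E2 := @probability_setT _ _ R (torus_measure d).
  by move: E; rewrite [X in (X * _)%E]E1 [X in (_ * X)%E]E2 mule1 => <-.
- exact/measurable_EFinP.
- exists M; split; first exact: num_real.
  by move=> y My x _; rewrite /= (le_trans (HM _))// ltW.
Qed.

Let torus_integral_cons : (torus_integral f)%:E =
  (\int[uniform_prob (@ltr01 R) \x torus_measure d]_z h z)%E.
Proof.
rewrite -torus_integral_EFin//.
transitivity (\int[pushforward (uniform_prob (@ltr01 R) \x torus_measure d)%E
  (@tuple_cons R d)]_(y in setT) (f (Defs.point y))%:E)%E; first by [].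
rewrite integral_pushforward//.
- by apply: eq_integral => z _; rewrite hE.
- by apply/measurable_EFinP; apply: measurable_fun_point; case: tf.
- by move: integrable_h; rewrite hE.
Qed.

Lemma torus_integral_cons12 : (torus_integral f)%:E =
  (\int[uniform_prob (@ltr01 R)]_s
     (torus_integral (fun y => f (row_cons s y)))%:E)%E.
Proof.
rewrite torus_integral_cons -(integral12_prod_meas1 integrable_h).
apply: eq_integral => s _; rewrite -torus_integral_EFin//.
exact: torus_continuous_cons.
Qed.

Lemma torus_integral_cons21 : (torus_integral f)%:E =
  (\int[torus_measure d]_y \int[uniform_prob (@ltr01 R)]_s
     (f (row_cons s (Defs.point y)))%:E)%E.
Proof. by rewrite torus_integral_cons -(integral21_prod_meas1 integrable_h). Qed.

End fubini.

(** Induction on the dimension. If [i] is not the first coordinate, the first variable is integrated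
    outermost and the inner integral vanishes by induction. If it is, the first variable is
    integrated innermost, and the fundamental theorem of calculus leaves a difference of values one
    period apart. *)
Lemma torus_integral_partial d (i : 'I_d) (f : 'rV[R]_d -> R) :
  torus_continuous f -> (forall x, derivable f x (delta_mx 0 i)) ->
  torus_continuous (partial i f) -> torus_integral (partial i f) = 0.
Proof.
elim: d i f => [[]//|d IH] i f tf df tdf; apply/EFin_inj.
case: (unliftP ord0 i) => [j ij|i0].
  rewrite torus_integral_cons12//; apply: integral0_eq => s _; congr EFin.
  have ds y : is_derive y (delta_mx 0 j) (fun y => f (row_cons s y))
      (partial i f (row_cons s y)).
    have y0 : y = 0 *: delta_mx 0 j + y by rewrite scale0r add0r.
    rewrite {1}y0; apply: line_is_derive.
    under eq_fun do rewrite row_cons_tail -ij.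
    apply: is_derive_line; rewrite scale0r add0r; exact: derivableP.
  rewrite -[RHS](IH j (fun y => f (row_cons s y))).
  - by apply: eq_torus_integral => y; rewrite /partial (@derive_val _ _ _ _ _ _ _ (ds y)).
  - exact: torus_continuous_cons.
  - by move=> y; have [] := ds y.
  - rewrite (_ : partial j _ = fun y => partial i f (row_cons s y)).
      exact: torus_continuous_cons.
    by apply/funext => y; rewrite /partial (@derive_val _ _ _ _ _ _ _ (ds y)).
rewrite torus_integral_cons21//; apply: integral0_eq => y _.
set F := fun s : R => f (row_cons s (Defs.point y)).
have dF (s : R) : is_derive s 1 F (partial i f (row_cons s (Defs.point y))).
  have e h : row_cons h (Defs.point y) = h *: delta_mx 0 i + row_cons 0 (Defs.point y).
    by rewrite i0 -row_cons_head addr0.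
  rewrite /F (e s); under eq_fun do rewrite e.
  apply: is_derive_line; exact: derivableP.
have cF : continuous F.
  move=> s; apply/differentiable_continuous/derivable1_diffP; exact: ex_derive.
have cdF : continuous (fun s : R => partial i f (row_cons s (Defs.point y))).
  move=> s; apply: continuous_comp; last by case: tdf => _; exact.
  exact: continuous_row_cons_head.
rewrite integral_uniform_signed; last first.
  by apply/measurable_EFinP; exact: continuous_measurable_fun.
rewrite (@continuous_FTC2 _ _ F)//.
- suff -> : F 1 = F 0 by rewrite -EFinB subrr.
  have := row_cons_head 1 0 (Defs.point y); rewrite addr0 /F => ->.
  rewrite scale1r addrC.
  by case: tf => pf _; rewrite pf.
- exact: continuous_subspaceT.
- split; first by move=> s _; exact: ex_derive.
  + by apply: cvg_at_right_filter; exact: cF.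
  + by apply: cvg_at_left_filter; exact: cF.
- by move=> s _; rewrite derive1E (@derive_val _ _ _ _ _ _ _ (dF s)).
Qed.

End integration_by_parts.

(** * From the essential supremum to a bound at every point *)

Section essential_bound.
Context {R : realType}.

(** Even when [c] is an endpoint, the intersection contains a nonempty open interval because a < b.
    Endpoints matter: the pointwise bound is wanted on closed time intervals and on the faces of the
    cube. *)
Lemma lebesgue_ball_gt0 (a b c e : R) : a < b -> a <= c <= b -> 0 < e ->
  (0 < lebesgue_measure (ball c e `&` `[a, b]))%E.
Proof.
move=> ab /andP[ac cb] e0.
pose u := Num.max a (c - e); pose v := Num.min b (c + e).
have uv : u < v by rewrite /u /v gt_max !lt_min; apply/andP; split; apply/andP; split; lra.
apply: (@lt_le_trans _ _ (lebesgue_measure (`]u, v[%classic : set R))).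
  by rewrite lebesgue_measure_itv /= lte_fin uv -EFinB lte_fin subr_gt0.
apply: le_measure; rewrite ?inE//.
  by apply: measurableI => //; apply: open_measurable; exact: ball_open.
move=> s; rewrite /= in_itv /= /u /v gt_max lt_min => /andP[/andP[h1 h2] /andP[h3 h4]].
split; first by rewrite -ball_normE /= ltr_distlC h2 h4.
by rewrite /= in_itv /= !ltW.
Qed.

Lemma uniform_ball_gt0 (c e : R) : 0 <= c <= 1 -> 0 < e ->
  (0 < uniform_prob (@ltr01 R) (ball c e))%E.
Proof.
move=> c01 e0.
have mA : measurable (ball c e : set R) by apply: open_measurable; exact: ball_open.
have E := @integral_indic _ _ R (uniform_prob (@ltr01 R)) setT measurableT _ mA.
rewrite setIT in E; rewrite -E integral_uniform; last first.
- by move=> x; rewrite lee_fin.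
- by apply/measurable_EFinP; exact: measurable_indic.
rewrite subr0 invr1 mul1e integral_indic//.
exact: lebesgue_ball_gt0.
Qed.

Lemma torus_box_gt0 d (c : 'I_d -> R) (e : R) :
  (forall i, 0 <= c i <= 1) -> 0 < e ->
  (0 < torus_measure d [set x : d.-tuple (measurableTypeR R) |
                        forall i, (`|c i - tnth x i| < e)%R])%E.
Proof.
move=> + e0; elim: d c => [c _|d IH c c01].
  by rewrite /= diracE mem_set ?lte01//; case.
pose A := ball (c ord0) e : set (measurableTypeR R).
pose B := [set x : d.-tuple (measurableTypeR R) |
   forall i, `|c (lift ord0 i) - tnth x i| < e].
have mA : measurable A by apply: open_measurable; exact: ball_open.
rewrite [X in (_ < X)%E](_ : _ =
   (uniform_prob (@ltr01 R) \x torus_measure d)%E (A `*` B)).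
  rewrite product_measure1E//; last exact: measurable_box.
  by rewrite mule_gt0//; [exact: uniform_ball_gt0|exact: IH].
rewrite /= /pushforward; congr ((_ \x _)%E _).
apply/seteqP; split=> [[s y] /= H|[s y] /= [As By] i].
  split; first by have := H ord0; rewrite tnth0 /A -ball_normE.
  by move=> i; have := H (lift ord0 i); rewrite tnthS.
case: (unliftP ord0 i) => [j ->|->]; first by rewrite tnthS; exact: By.
by move: As; rewrite tnth0 /A -ball_normE.
Qed.

(** If |F| exceeded K somewhere, continuity would make it exceed K on a whole box, which has
    positive measure. [F] is a continuous representative of [L], whose values outside [0,T] are
    arbitrary. *)
Lemma cylinder_Linfty_bound d (T K : R) (L F : R -> 'rV[R]_d -> R) :
  0 < T -> (forall t x, 0 <= t <= T -> L t x = F t x) ->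
  (forall t, 0 <= t <= T -> Defs.periodic (F t)) ->
  (forall t x, 0 <= t <= T -> {for (t, x), continuous (fun z => F z.1 z.2)}) ->
  (cylinder_Linfty T L <= K%:E)%E ->
  forall t x, 0 <= t <= T -> `|F t x| <= K.
Proof.
move=> T0 LF pF cF LK t x t0T; rewrite leNgt; apply/negP => KF.
rewrite -(periodic_fractional_part x (pF t t0T)) in KF.
set y := fractional_part x in KF.
have [e e0 Fe] : exists2 e : R, 0 < e & forall s z, `|t - s| < e ->
    ball y e z -> K < `|F s z|.
  have : \forall z \near (t, y), K < `|F z.1 z.2|.
    have /cvg_norm /cvgr_gt := cF t y t0T; exact.
  move=> /nbhs_ballP[e /= e0 He]; exists e => // s z ts yz.
  by apply: (He (s, z)); split => //=; rewrite -ball_normE.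
pose A := ball t e `&` `[0, T] : set (measurableTypeR R).
pose B := [set x : d.-tuple (measurableTypeR R) | forall i, `|y 0 i - tnth x i| < e].
have mA : measurable A.
  by apply: measurableI => //; apply: open_measurable; exact: ball_open.
have mB : measurable B by exact: measurable_box.
have AB0 : (0 < cylinder_measure d T (A `*` B))%E.
  rewrite [X in (_ < X)%E](product_measure1E _ _ mA mB) mule_gt0//.
    have -> : time_measure T A = lebesgue_measure (A `&` `[0, T]) by [].
    by rewrite /A -setIA setIid; exact: lebesgue_ball_gt0.
  apply: torus_box_gt0 => // i.
  by have := fractional_part_itv x i; rewrite in_itv /= => /andP[-> /ltW].
have mT0 : (0 < cylinder_measure d T setT)%E.
  by apply: (lt_le_trans AB0); apply: le_measure; rewrite ?inE//; exact: measurableX.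
move: LK; rewrite /cylinder_Linfty unlock mT0 => /ess_supP[N [mN N0 LN]].
suff : (cylinder_measure d T (A `*` B) <= cylinder_measure d T N)%E.
  by rewrite N0 leNgt AB0.
apply: le_measure; rewrite ?inE//; first exact: measurableX.
move=> [s z] /= [[ts sT] zB]; apply: LN => /=.
move: sT; rewrite /= in_itv /= => sT.
rewrite lee_fin LF//; apply/negP; rewrite -ltNge; apply: Fe.
  by move: ts; rewrite -ball_normE.
by apply/rV_ballP => // i; rewrite [Defs.point z 0 i]mxE; exact: zB.
Qed.

End essential_bound.

(** * Evolution of the energy *)

Section semiconvexity.
Context {R : realType}.

(* At an interior maximum point c of value M one has phi'(c) = 0 and
   phi'' >= - k M, so that phi(T) >= M - k M (T - c)^2 / 2. *)
Lemma semiconvex_max_le (phi phi1 phi2 : R -> R) (T k A : R) :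
  0 < T -> 0 <= k -> k * T ^+ 2 / 2 < 1 ->
  {within `[0, T], continuous phi} ->
  (forall t : R, 0 < t < T -> is_derive t 1 phi (phi1 t)) ->
  (forall t : R, 0 < t < T -> is_derive t 1 phi1 (phi2 t)) ->
  (forall t, 0 < t < T -> - (k * phi t) <= phi2 t) ->
  (forall t, 0 <= t <= T -> 0 <= phi t) -> phi 0 <= A -> phi T <= A ->
  forall t, 0 <= t <= T -> phi t <= A / (1 - k * T ^+ 2 / 2).
Proof.
move=> T0 k0 kT cphi dphi dphi1 phi2_ge phi_ge0 A0 AT.
have [c c0T phi_max] := EVT_max (ltW T0) cphi.
rewrite in_itv /= in c0T.
suff MA : phi c * (1 - k * T ^+ 2 / 2) <= A.
  move=> t t0T; apply: (@le_trans _ _ (phi c)).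
    by apply: phi_max; rewrite in_itv.
  by rewrite ler_pdivlMr// subr_gt0.
have M0 := phi_ge0 _ c0T.
have kT0 : 0 <= k * T ^+ 2 / 2 by rewrite divr_ge0// mulr_ge0// sqr_ge0.
(* A maximum at an endpoint is at most A, and the factor 1 - k T^2 / 2 is at most 1. *)
have [cE|c_neq0] := eqVneq c 0.
  by apply: le_trans A0; rewrite -cE ler_piMr// gerBl.
have [cE|c_neqT] := eqVneq c T.
  have pT : phi T = phi c by rewrite cE.
  by apply: le_trans AT; rewrite pT ler_piMr// gerBl.
have {}c0T : 0 < c < T.
  by move/andP: c0T => [h1 h2]; rewrite !lt_neqAle h1 h2 eq_sym c_neq0 c_neqT.
have phi1c : phi1 c = 0.
  have H : is_derive c 1 phi 0.
    apply: (@derive1_at_max _ phi 0 T c (ltW T0)) => //.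
    - by move=> t; rewrite in_itv /= => /dphi [].
    - by move=> t; rewrite in_itv /= => /andP[/ltW h1 /ltW h2]; apply: phi_max;
        rewrite in_itv /= h1.
  by rewrite -(@derive_val _ _ _ _ _ _ _ (dphi c c0T)) (@derive_val _ _ _ _ _ _ _ H).
have [c0 cT] := andP c0T.
pose M := phi c.
(* The added term compensates phi'' >= - k phi >= - k M, so [chi1] grows from its value 0 at c. Its
   primitive [chi] is then nondecreasing on [c,T]. *)
pose chi1 t := phi1 t + k * M * (t - c).
have chi1_ge0 t : c < t < T -> 0 <= chi1 t.
  move=> /andP[ct tT].
  have d1 s : s \in `]c, t[ -> is_derive s 1 chi1 (phi2 s + k * M).
    rewrite in_itv /= => /andP[cs st].
    have ds : is_derive s 1 phi1 (phi2 s).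
      by apply: dphi1; rewrite (lt_trans c0)// (lt_trans st).
    by rewrite /chi1; apply: is_derive_eq; rewrite subr0 [_ *: _]mulr1.
  have c1 : {within `[c, t], continuous chi1}.
    apply: derivable_within_continuous => s; rewrite in_itv /= => /andP[cs st].
    have ds : is_derive s 1 phi1 (phi2 s).
      by apply: dphi1; rewrite (lt_le_trans c0)// (le_lt_trans st).
    by rewrite /chi1; apply: ex_derive.
  have [s] := MVT ct d1 c1; rewrite in_itv /= => /andP[cs st] E.
  have -> : chi1 t = (phi2 s + k * M) * (t - c).
    by rewrite -E /chi1 phi1c subrr mulr0 addr0 subr0.
  have s0T : 0 < s < T by rewrite (lt_trans c0)// (lt_trans st).
  rewrite mulr_ge0 ?subr_ge0 ?(ltW ct)// -lerBlDr sub0r.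
  apply: le_trans (phi2_ge s s0T); rewrite lerN2 ler_wpM2l//.
  by apply: phi_max; case/andP: s0T => /ltW h1 /ltW h2; rewrite in_itv /= h1.
pose chi t := phi t + k * M / 2 * (t - c) ^+ 2.
have d0 s : s \in `]c, T[ -> is_derive s 1 chi (chi1 s).
  rewrite in_itv /= => /andP[cs st].
  have ds : is_derive s 1 phi (phi1 s) by apply: dphi; rewrite (lt_trans c0).
  by rewrite /chi /chi1; apply: is_derive_eq; rewrite /GRing.scale /=; field.
have cchi : {within `[c, T], continuous chi}.
  move=> s; apply: (@continuousD _ _ _ (phi : subspace _ -> R)).
    apply: (continuous_subspaceW _ cphi) => z /=.
    by rewrite !in_itv /= => /andP[h1 ->]; rewrite (le_trans _ h1)// ltW.
  apply: continuous_subspaceT => z.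
  by apply/differentiable_continuous/derivable1_diffP; apply: ex_derive.
have [s sI E] := MVT cT d0 cchi.
have : chi c <= chi T.
  rewrite -subr_ge0 E mulr_ge0 ?subr_ge0 ?(ltW cT)//.
  by apply: chi1_ge0; rewrite in_itv in sI.
rewrite /chi subrr expr0n /= mulr0 addr0 => H.
have : k * M / 2 * (T - c) ^+ 2 <= k * M / 2 * T ^+ 2.
  rewrite ler_wpM2l ?divr_ge0 ?mulr_ge0// ler_sqr ?nnegrE ?subr_ge0 ?ltW//.
  by rewrite gtrBl.
rewrite -/M in H *; nra.
Qed.

End semiconvexity.

(** * Time derivatives of integrals over the torus *)

Section parametric_integral.
Context {R : realType} {d : nat} (T : R) (f df : R -> 'rV[R]_d -> R).
Hypothesis periodic_f : forall t, 0 <= t <= T -> Defs.periodic (f t).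
Hypothesis periodic_df : forall t, 0 <= t <= T -> Defs.periodic (df t).
Hypothesis cont_f : forall t x, 0 <= t <= T ->
  {for (t, x), continuous (fun z => f z.1 z.2)}.
Hypothesis cont_df : forall t x, 0 <= t <= T ->
  {for (t, x), continuous (fun z => df z.1 z.2)}.
Hypothesis derive_f : forall (t : R) x, 0 < t < T -> is_derive t 1 (f ^~ x) (df t x).

Lemma slice_torus_continuous (h : R -> 'rV[R]_d -> R) t : Defs.periodic (h t) ->
  (forall x, {for (t, x), continuous (fun z => h z.1 z.2)}) -> torus_continuous (h t).
Proof.
move=> ph ch; split=> // x.
apply: (@continuous_comp _ _ _ (fun x => (t, x)) (fun z => h z.1 z.2)); last exact: ch.
exact: continuous_pairr.
Qed.

Let continuous_time t x : 0 <= t <= T -> {for t, continuous (f ^~ x)}.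
Proof.
move=> t0T.
apply: (@continuous_comp _ _ _ (fun t => (t, x)) (fun z => f z.1 z.2)); last exact: cont_f.
exact: continuous_pairl.
Qed.

Let torus_continuous_f t : 0 <= t <= T -> torus_continuous (f t).
Proof. by move=> t0T; apply: slice_torus_continuous; auto. Qed.

Lemma is_derive_torus_integral (t : R) : 0 < t < T ->
  is_derive t 1 (fun s => torus_integral (f s)) (torus_integral (df t)).
Proof.
move=> t0T; have [M M0 HM] := periodic_bounded periodic_df cont_df.
have It : `]0%R, T[%classic t by rewrite /= in_itv.
have intf s : `]0%R, T[%classic s ->
    (torus_measure d).-integrable setT (EFin \o (fun y => f s (Defs.point y))).
  rewrite /= in_itv /= => /andP[/ltW s0 /ltW sT]; apply: torus_integrable.
  by apply: torus_continuous_f; rewrite s0.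
have derf s (y : d.-tuple (measurableTypeR R)) : `]0%R, T[%classic s -> setT y ->
    derivable (fun s => f s (Defs.point y)) s 1.
  by rewrite /= in_itv /= => s0T _; have [] := derive_f (Defs.point y) s0T.
have dfE s (y : d.-tuple (measurableTypeR R)) : 0 < s < T ->
    partial1of2 (fun s y => f s (Defs.point y)) s y = df s (Defs.point y).
  by move=> s0T; rewrite partial1of2E (@derive_val _ _ _ _ _ _ _ (derive_f _ s0T)).
have ub s (y : d.-tuple (measurableTypeR R)) : `]0%R, T[%classic s -> setT y ->
    `|partial1of2 (fun s y => f s (Defs.point y)) s y| <= cst M y.
  rewrite /= in_itv /= => s0T _; rewrite dfE//; apply: HM.
  by case/andP: s0T => /ltW -> /ltW ->.
have intM : (torus_measure d).-integrable setT (EFin \o cst M).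
  exact: (torus_integrable (torus_continuous_cst M)).
split.
  exact: (derivable_under_integral measurableT It intf derf (fun=> M0) intM ub).
rewrite -derive1E.
rewrite (differentiation_under_integral measurableT It intf derf (fun=> M0) intM ub).
by apply: eq_Rintegral => y _; rewrite dfE.
Qed.

(** The derivative is given only inside (0,T), but [df] is bounded on the closed interval, so the
    mean value theorem makes [f], and hence its integral, Lipschitz in time up to the endpoints.
    This is where the energy gets tied to its initial and final values. *)
Lemma within_continuous_torus_integral :
  {within `[0, T], continuous (fun s => torus_integral (f s))}.
Proof.
have [M M0 HM] := periodic_bounded periodic_df cont_df.
have lip_f s t x : 0 <= s -> s <= t -> t <= T -> `|f t x - f s x| <= M * (t - s).
  move=> s0 st tT.
  have D r : r \in `]s, t[ -> is_derive r 1 (f ^~ x) (df r x).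
    rewrite in_itv /= => /andP[sr rt]; apply: derive_f.
    by rewrite (le_lt_trans s0 sr) (lt_le_trans rt tT).
  have C : {within `[s, t], continuous (f ^~ x)}.
    apply: continuous_in_subspaceT => r; rewrite inE /= in_itv /= => /andP[sr rt].
    by apply: continuous_time; rewrite (le_trans s0 sr) (le_trans rt tT).
  have [r] := MVT_segment st D C; rewrite in_itv /= => /andP[sr rt] ->.
  rewrite normrM (ger0_norm (_ : 0 <= t - s)) ?subr_ge0// ler_wpM2r ?subr_ge0//.
  by apply: HM; rewrite (le_trans s0 sr) (le_trans rt tT).
have lip s t : 0 <= s -> s <= t -> t <= T ->
    `|torus_integral (f t) - torus_integral (f s)| <= M * (t - s).
  move=> s0 st tT.
  have ts : torus_continuous (f s) by apply: torus_continuous_f; rewrite s0 (le_trans st tT).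
  have tt : torus_continuous (f t) by apply: torus_continuous_f; rewrite tT (le_trans s0 st).
  have tst := torus_continuousD tt (torus_continuousN ts).
  rewrite -torus_integralB// ler_norml; apply/andP; split.
    rewrite -[leLHS](torus_integral_cst (d := d)); apply: le_torus_integral => //.
      exact: torus_continuous_cst.
    by move=> x; have := lip_f s t x s0 st tT; rewrite ler_norml => /andP[].
  rewrite -[leRHS](torus_integral_cst (d := d)); apply: le_torus_integral => //.
    exact: torus_continuous_cst.
  by move=> x; have := lip_f s t x s0 st tT; rewrite ler_norml => /andP[].
have lip2 s t : 0 <= s <= T -> 0 <= t <= T ->
    `|torus_integral (f s) - torus_integral (f t)| <= M * `|s - t|.
  move=> /andP[s0 sT] /andP[t0 tT]; have [st|/ltW ts] := leP s t.
    by rewrite distrC (distrC s) (ger0_norm (_ : 0 <= t - s)) ?subr_ge0// lip.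
  by rewrite (ger0_norm (_ : 0 <= s - t)) ?subr_ge0// lip.
apply/subspace_continuousP => s /=; rewrite in_itv /= => s0T.
apply/cvgrPdist_lt => e e0; near=> t.
have tI : 0 <= t <= T.
  have : `[0, T]%classic t by near: t; exact: withinT.
  by rewrite /= in_itv.
apply: (le_lt_trans (lip2 _ _ s0T tI)).
(* M may be 0; M + 1 can be divided by. *)
apply: (@le_lt_trans _ _ ((M + 1) * `|s - t|)); first by rewrite ler_wpM2r// lerDl.
rewrite mulrC -ltr_pdivlMr ?ltr_wpDl//.
near: t; apply: cvg_within; apply/nbhs_ballP; exists (e / (M + 1)) => /=.
  by rewrite divr_gt0// ltr_wpDl.
by move=> t; rewrite -ball_normE.
Unshelve. all: by end_near. Qed.

End parametric_integral.

(** * The divergence theorem for periodic fields of class C^1 *)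

Section divergence_theorem.
Context {R : realType} {d : nat}.
Implicit Types (f g : 'rV[R]_d -> R) (i : 'I_d).

Lemma partialE f i x df : is_derive x (delta_mx 0 i) f df -> partial i f x = df.
Proof. by move=> H; rewrite /partial (@derive_val _ _ _ _ _ _ _ H). Qed.

Lemma periodic_partial f i : Defs.periodic f -> Defs.periodic (partial i f).
Proof.
move=> pf x j; rewrite /partial /derive pf.
rewrite (_ : f \o shift (x + delta_mx 0 j) = f \o shift x)//.
by apply/funext => h /=; rewrite addrA pf.
Qed.

Definition torus_C1 f := torus_continuous f /\
  forall i, (forall x, derivable f x (delta_mx 0 i)) /\ torus_continuous (partial i f).

Lemma torus_C1_continuous f : torus_C1 f -> torus_continuous f.
Proof. by case. Qed.

Lemma torus_C1_partial f i : torus_C1 f -> torus_continuous (partial i f).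
Proof. by case=> _ /(_ i)[]. Qed.

Lemma torus_C1_is_derive f i x : torus_C1 f ->
  is_derive x (delta_mx 0 i) f (partial i f x).
Proof. by case=> _ /(_ i)[df _]; exact: derivableP. Qed.

Lemma torus_C1_intro f (df : 'I_d -> 'rV[R]_d -> R) : torus_continuous f ->
  (forall i, torus_continuous (df i)) ->
  (forall i x, is_derive x (delta_mx 0 i) f (df i x)) -> torus_C1 f.
Proof.
move=> tf tdf H; split=> // i; split; first by move=> x; have [] := H i x.
by rewrite (_ : partial i f = df i)//; apply/funext => x; exact: partialE.
Qed.

Lemma is_derive_mul f g i x (df dg : R) :
  is_derive x (delta_mx 0 i) f df -> is_derive x (delta_mx 0 i) g dg ->
  is_derive x (delta_mx 0 i) (fun y => f y * g y) (df * g x + f x * dg).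
Proof.
move=> hf hg; have H := is_deriveM hf hg.
rewrite (_ : df * g x + f x * dg = f x *: dg + g x *: df)//.
by rewrite /GRing.scale /= addrC (mulrC (g x)).
Qed.

Lemma torus_C1M f g : torus_C1 f -> torus_C1 g -> torus_C1 (fun x => f x * g x).
Proof.
move=> Cf Cg.
apply: (@torus_C1_intro _ (fun i x => partial i f x * g x + f x * partial i g x)).
- by apply: torus_continuousM; exact: torus_C1_continuous.
- move=> i; apply: torus_continuousD; apply: torus_continuousM.
  + exact: torus_C1_partial.
  + exact: torus_C1_continuous.
  + exact: torus_C1_continuous.
  + exact: torus_C1_partial.
- by move=> i x; apply: is_derive_mul; exact: torus_C1_is_derive.
Qed.

Lemma torus_C1B f g : torus_C1 f -> torus_C1 g -> torus_C1 (fun x => f x - g x).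
Proof.
move=> Cf Cg.
apply: (@torus_C1_intro _ (fun i x => partial i f x - partial i g x)).
- by apply: torus_continuousD; [|apply: torus_continuousN]; exact: torus_C1_continuous.
- move=> i; apply: torus_continuousD; [|apply: torus_continuousN]; exact: torus_C1_partial.
- by move=> i x; apply: is_deriveB; exact: torus_C1_is_derive.
Qed.

(** Differentiability of [P] is asked only at values of [f]: the energies are controlled on [0,+oo)
    alone, where m takes its values. *)
Lemma torus_C1_comp (P P' : R -> R) f : torus_C1 f ->
  (forall x, is_derive (f x) 1 P (P' (f x))) ->
  (forall x, {for f x, continuous P'}) -> torus_C1 (fun x => P (f x)).
Proof.
move=> Cf dP cP.
apply: (@torus_C1_intro _ (fun i x => P' (f x) * partial i f x)).
- apply: torus_continuous_comp; first exact: torus_C1_continuous.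
  move=> x; apply/differentiable_continuous/derivable1_diffP.
  by have [] := dP x.
- move=> i; apply: torus_continuousM; last exact: torus_C1_partial.
  by apply: torus_continuous_comp => //; exact: torus_C1_continuous.
- by move=> i x; apply: is_derive_comp1 => //; exact: torus_C1_is_derive.
Qed.

Lemma torus_integral_divergence (F : 'I_d -> 'rV[R]_d -> R) :
  (forall i, torus_C1 (F i)) ->
  torus_integral (fun x => \sum_i partial i (F i) x) = 0.
Proof.
move=> CF; rewrite torus_integral_sum; last by move=> i; exact: torus_C1_partial.
apply: big1 => i _; have [tF /(_ i)[dF tdF]] := CF i.
exact: torus_integral_partial.
Qed.

End divergence_theorem.

(** * Variations of the energy at a fixed time: [a] is Du, [L] is Lap u, [gamma] is D(g(m)) *)

Section displacement_convexity.
Context {R : realType} {d : nat}.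
Variables (m : 'rV[R]_d -> R) (a : 'I_d -> 'rV[R]_d -> R).
Hypotheses (Cm : torus_C1 m) (Ca : forall i, torus_C1 (a i)).
Let L x := \sum_i partial i (a i) x.

(** The two integrands differ by the divergence of the field U(m) a. *)
Lemma energy_first_variation (U U' : R -> R) :
  (forall x, is_derive (m x) 1 U (U' (m x))) ->
  (forall x, {for m x, continuous U'}) ->
  torus_integral (fun x => U' (m x) *
      (\sum_i (partial i m x * a i x + m x * partial i (a i) x))) =
  torus_integral (fun x => (m x * U' (m x) - U (m x)) * L x).
Proof.
move=> dU cU.
have CU : torus_C1 (fun x => U (m x)) by exact: torus_C1_comp dU cU.
have tU' : torus_continuous (fun x => U' (m x)).
  by apply: torus_continuous_comp => //; exact: torus_C1_continuous.
have tL : torus_continuous L.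
  by apply: torus_continuous_sum => i; exact: torus_C1_partial.
have CF i : torus_C1 (fun x => U (m x) * a i x) by exact: torus_C1M.
have := torus_integral_divergence CF => I0.
rewrite -[RHS]addr0 -[X in _ = _ + X]I0 -torus_integralD; last 2 first.
- apply: torus_continuousM => //; apply: torus_continuousD.
    by apply: torus_continuousM => //; exact: torus_C1_continuous.
  by apply: torus_continuousN; exact: torus_C1_continuous.
- by apply: torus_continuous_sum => i; exact: torus_C1_partial.
apply: eq_torus_integral => x.
rewrite /L !mulr_sumr -big_split /=.
apply: eq_bigr => i _.
rewrite (partialE (is_derive_mul (is_derive_comp1 (dU x) (torus_C1_is_derive i x Cm))
  (torus_C1_is_derive i x (Ca i)))).
ring.
Qed.

Hypothesis CL : torus_C1 L.
Variable gamma : 'I_d -> 'rV[R]_d -> R.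
Hypothesis Cgamma : forall i, torus_C1 (gamma i).
Variables G' lapV : 'rV[R]_d -> R.
Hypothesis gammaE : forall i x, gamma i x = G' x * partial i m x.
Hypothesis G'_ge0 : forall x, 0 <= G' x.

(* Subtracting from X the divergence of the field P(m) (a_i L - gamma_i) leaves
   an integrand that is bounded below pointwise. *)
Lemma energy_second_variation_ge (P P' U : R -> R) (p K : R) :
  (forall x, 0 <= m x) ->
  (forall y : R, 0 <= y -> is_derive y 1 P (P' y)) ->
  (forall y : R, 0 <= y -> {for y, continuous P'}) ->
  (forall y : R, 0 <= y -> 0 <= P' y) ->
  (forall y : R, 0 <= y -> `|P y| <= p * U y) ->
  (forall (y : R) (A : 'I_d -> 'I_d -> R), 0 <= y ->
     0 <= (y * P' y - P y) * (\sum_i A i i) ^+ 2 + P y * \sum_i \sum_j A i j ^+ 2) ->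
  (forall x, `|lapV x| <= K) ->
  torus_continuous (fun x => U (m x)) ->
  let X x := P' (m x) * (\sum_i (partial i m x * a i x + m x * partial i (a i) x)) * L x
    + P (m x) * (\sum_i \sum_j partial i (a j) x ^+ 2 + \sum_i a i x * partial i L x
                 + lapV x - \sum_i partial i (gamma i) x) in
  torus_continuous X ->
  - (K * p * torus_integral (fun x => U (m x))) <= torus_integral X.
Proof.
move=> m0 dP cP P'0 PU matP lapK tU X tX.
have dPm x : is_derive (m x) 1 P (P' (m x)) by apply: dP.
have CP : torus_C1 (fun x => P (m x)).
  by apply: (torus_C1_comp Cm dPm) => x; exact: cP.
pose F i x := P (m x) * (a i x * L x - gamma i x).
have CF i : torus_C1 (F i).
  exact: torus_C1M CP (torus_C1B (torus_C1M (Ca i) CL) (Cgamma i)).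
have FE i x : partial i (F i) x =
    P' (m x) * partial i m x * (a i x * L x - gamma i x) +
    P (m x) * (partial i (a i) x * L x + a i x * partial i L x - partial i (gamma i) x).
  apply: partialE; apply: is_derive_mul.
    exact: is_derive_comp1 (dPm x) (torus_C1_is_derive i x Cm).
  apply: is_deriveB; last exact: torus_C1_is_derive.
  by apply: is_derive_mul; exact: torus_C1_is_derive.
have tF : torus_continuous (fun x => \sum_i partial i (F i) x).
  by apply: torus_continuous_sum => i; exact: torus_C1_partial.
rewrite -[leRHS]subr0 -[X in _ - X](torus_integral_divergence CF) -torus_integralB//.
rewrite -torus_integralZl// -torus_integralN; last first.
  by apply: torus_continuousM => //; exact: torus_continuous_cst.
apply: le_torus_integral.
- by apply: torus_continuousN; apply: torus_continuousM => //; exact: torus_continuous_cst.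
- by apply: torus_continuousD => //; exact: torus_continuousN.
move=> x.
set y := m x; set S := \sum_i partial i m x * a i x.
have y0 : 0 <= y by exact: m0.
have XE : X x = P' y * (S + y * L x) * L x + P y *
   (\sum_i \sum_j partial i (a j) x ^+ 2 + \sum_i a i x * partial i L x
                 + lapV x - \sum_i partial i (gamma i) x).
  by rewrite /X big_split /= -mulr_sumr.
(* The product of Dm with [gamma] becomes G' |Dm|^2 by [gammaE]. The terms in a . DL and in the
   divergence of [gamma] match those of [X], so they cancel in the difference. *)
have FsE : \sum_i partial i (F i) x = P' y * S * L x
    - P' y * (G' x * \sum_i partial i m x ^+ 2)
    + P y * (L x ^+ 2 + \sum_i a i x * partial i L x - \sum_i partial i (gamma i) x).
  have -> : P' y * S * L x = \sum_i P' y * (partial i m x * a i x) * L x.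
    by rewrite /S mulr_sumr mulr_suml.
  have -> : P' y * (G' x * \sum_i partial i m x ^+ 2) =
      \sum_i P' y * (G' x * partial i m x ^+ 2) by rewrite 2!mulr_sumr.
  have -> : L x ^+ 2 + \sum_i a i x * partial i L x - \sum_i partial i (gamma i) x =
      \sum_i (partial i (a i) x * L x + a i x * partial i L x - partial i (gamma i) x).
    by rewrite sumrB big_split -mulr_suml.
  rewrite mulr_sumr -sumrB -big_split /=.
  by apply: eq_bigr => i _; rewrite FE -/y {1}gammaE; ring.
rewrite XE FsE.
set A2 := \sum_i \sum_j _; set DL := \sum_i _ * _; set LG := \sum_i partial i (gamma i) x.
set M2 := \sum_i _ ^+ 2.
have M0 : 0 <= P' y * (G' x * M2).
  by rewrite mulr_ge0 ?P'0// mulr_ge0// sumr_ge0// => i _; exact: sqr_ge0.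
have := matP y (fun i j => partial i (a j) x) y0; rewrite -/A2 -/(L x) => H.
have PV : - (K * p * U y) <= P y * lapV x.
  have : `|P y * lapV x| <= p * U y * K by rewrite normrM ler_pM// PU.
  by rewrite ler_norml => /andP[+ _]; rewrite (mulrC _ K) mulrA.
(* What remains is the quadratic form of [matP], the term P' G' |Dm|^2 and P times the Laplacian of
   V; only the last can be negative, by at most K p U. *)
rewrite -subr_ge0.
apply: le_trans (addr_ge0 (addr_ge0 H M0) (_ : 0 <= P y * lapV x + K * p * U y)) _.
  by rewrite -lerBlDr sub0r.
by rewrite le_eqVlt; apply/orP; left; apply/eqP; ring.
Qed.

End displacement_convexity.

(** * Smooth functions of time and space, periodic in space *)

Section smooth_cylinders.
Context {R : realType} {d : nat}.
Implicit Types (F H : R * 'rV[R]_d -> R) (v : R * 'rV[R]_d) (i : 'I_d).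

Definition space_dir i : R * 'rV[R]_d := (0, delta_mx 0 i).

Definition time_dir : R * 'rV[R]_d := (1, 0).

Definition smooth_periodic F := smooth F /\ forall z i, F (z + space_dir i) = F z.

Lemma smooth_periodic_derive F v : smooth_periodic F -> smooth_periodic ('D_v F).
Proof.
move=> [sF pF]; split=> [|z i]; first exact: smooth_derive.
rewrite /derive pF (_ : F \o shift (z + space_dir i) = F \o shift z)//.
by apply/funext => h /=; rewrite addrA pF.
Qed.

Lemma smooth_periodicD F H : smooth_periodic F -> smooth_periodic H ->
  smooth_periodic (fun z => F z + H z).
Proof. by move=> [? pF] [? pH]; split=> [|z i]; [exact: smoothD|rewrite pF pH]. Qed.

Lemma smooth_periodicM F H : smooth_periodic F -> smooth_periodic H ->
  smooth_periodic (fun z => F z * H z).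
Proof. by move=> [? pF] [? pH]; split=> [|z i]; [exact: smoothM|rewrite pF pH]. Qed.

Lemma smooth_periodicN F : smooth_periodic F -> smooth_periodic (fun z => - F z).
Proof. by move=> [? pF]; split=> [|z i]; [exact: smoothN|rewrite pF]. Qed.

Lemma smooth_periodic_cst c : smooth_periodic (fun=> c).
Proof. by split=> //; exact: smooth_cst. Qed.

Lemma smooth_periodic_sum (I : Type) (r : seq I) (F : I -> R * 'rV[R]_d -> R) :
  (forall k, smooth_periodic (F k)) -> smooth_periodic (fun z => \sum_(k <- r) F k z).
Proof.
move=> sF; split=> [|z i]; first by apply: smooth_sum => i; case: (sF i).
by apply: eq_bigr => j _; case: (sF j).
Qed.

Lemma smooth_periodic_slice F t : smooth_periodic F -> Defs.periodic (fun x => F (t, x)).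
Proof.
move=> [_ pF] x i; rewrite -[RHS](pF _ i); congr F.
by rewrite [RHS]surjective_pairing /= addr0.
Qed.

Lemma smooth_periodic_continuous F : smooth_periodic F -> continuous F.
Proof. by move=> [sF _]; exact: smooth_continuous. Qed.

Lemma smooth_periodic_is_derive F v z : smooth_periodic F ->
  is_derive z v F ('D_v F z).
Proof. by move=> [sF _]; apply: derivableP; exact: smooth_derivable. Qed.

Lemma smooth_periodic_partial F t x i : smooth_periodic F ->
  is_derive x (delta_mx 0 i) (fun y => F (t, y)) ('D_(space_dir i) F (t, x)).
Proof. by move=> sF; apply: is_derive_slice_space; exact: smooth_periodic_is_derive. Qed.

Lemma smooth_periodic_time F (t : R) x : smooth_periodic F ->
  is_derive t 1 (fun s => F (s, x)) ('D_time_dir F (t, x)).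
Proof. by move=> sF; apply: is_derive_slice_time; exact: smooth_periodic_is_derive. Qed.

Lemma smooth_periodic_partialE F t i : smooth_periodic F ->
  partial i (fun x => F (t, x)) = fun x => 'D_(space_dir i) F (t, x).
Proof.
by move=> sF; apply/funext => x; apply: partialE; exact: smooth_periodic_partial.
Qed.

Lemma smooth_periodic_C1 F t : smooth_periodic F -> torus_C1 (fun x => F (t, x)).
Proof.
move=> sF; apply: (@torus_C1_intro _ _ _ (fun i x => 'D_(space_dir i) F (t, x))).
- split; first exact: (smooth_periodic_slice t sF).
  have H := @continuous_slice R _ F t (smooth_periodic_continuous sF).
  exact: H.
- move=> i; have sD := smooth_periodic_derive (space_dir i) sF.
  split; first exact: (smooth_periodic_slice t sD).
  have H := @continuous_slice R _ _ t (smooth_periodic_continuous sD).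
  exact: H.
- by move=> i x; exact: smooth_periodic_partial.
Qed.

(** The agreement is an equality of functions of x for each t in [0,T], so all space derivatives
    agree there, end times included. *)
Lemma smooth_cylinder_extension T (f : R -> 'rV[R]_d -> R) : smooth_cylinder T f ->
  exists F : R * 'rV[R]_d -> R, smooth_periodic F /\
    forall t, 0 <= t <= T -> f t = fun x => F (t, x).
Proof.
move=> [F [sF pF Ff]]; exists (fun z => F z.1 z.2); split.
  split=> // -[t x] i; rewrite /= addr0; exact: pF.
by move=> t t0T; apply/funext => x /=; rewrite Ff.
Qed.

Lemma laplacian_slice (f : 'rV[R]_d -> R) F t : smooth_periodic F ->
  f = (fun x => F (t, x)) ->
  laplacian f = fun x => \sum_i 'D_(space_dir i) ('D_(space_dir i) F) (t, x).
Proof.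
move=> sF fE; apply/funext => x; rewrite /laplacian /divergence; apply: eq_bigr => i _.
have -> : (fun y => gradient f y 0 i) = fun y => 'D_(space_dir i) F (t, y).
  by apply/funext => y; rewrite mxE fE smooth_periodic_partialE.
have /(congr1 (@^~ x)) H := smooth_periodic_partialE t i
  (smooth_periodic_derive (space_dir i) sF).
exact: H.
Qed.

End smooth_cylinders.

(** * The Bochner formula along the first equation *)

Section time_derivative_of_laplacian.
Context {R : realType} {W : normedModType R} (d : nat) (e : 'I_d -> W) (tau : W).
Variables u V : W -> R.
Hypotheses (su : smooth u) (sV : smooth V).

(* Smooth everywhere, and equal to g(m) for 0 < t < T by the first equation. *)
Definition hamilton_jacobi_defect (z : W) : R :=
  2^-1 * (\sum_i 'D_(e i) u z * 'D_(e i) u z) + V z - 'D_tau u z.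

Lemma smooth_hamilton_jacobi_defect : smooth hamilton_jacobi_defect.
Proof.
apply: smoothD; last by apply: smoothN; exact: smooth_derive.
apply: smoothD => //; apply: smoothM; first exact: smooth_cst.
by apply: smooth_sum => i; apply: smoothM; exact: smooth_derive.
Qed.

Lemma eq_fun_derive (f h : W -> R) v z : f =1 h -> 'D_v f z = 'D_v h z.
Proof. by move=> /funext ->. Qed.

Lemma derive_smooth_sum (I : finType) (F : I -> W -> R) v z : (forall i, smooth (F i)) ->
  'D_v (fun z => \sum_i F i z) z = \sum_i 'D_v (F i) z.
Proof.
move=> sF; elim: (index_enum I) => [|i r IH].
  by under eq_fun do rewrite big_nil; rewrite big_nil; exact: derive_cst.
under eq_fun do rewrite big_cons.
rewrite big_cons -IH; apply: deriveD; apply: smooth_derivable => //.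
exact: smooth_sum.
Qed.

Lemma derive_smoothM (F H : W -> R) v z : smooth F -> smooth H ->
  'D_v (fun z => F z * H z) z = 'D_v F z * H z + F z * 'D_v H z.
Proof.
move=> sF sH; rewrite (@deriveM _ _ F H); [|exact: smooth_derivable|exact: smooth_derivable].
by rewrite /GRing.scale /= addrC (mulrC (H z)).
Qed.

(** By definition of the defect, u_t = |Du|^2 / 2 + V - defect holds identically, so no equation is
    used here. Taking the Laplacian gives the Bochner identity Lap(|Du|^2 / 2) = |D^2 u|^2 + Du . D
    Lap u. *)
Lemma derive_time_laplacian z :
  'D_tau (fun z => \sum_i 'D_(e i) ('D_(e i) u) z) z =
  \sum_i \sum_j 'D_(e i) ('D_(e j) u) z ^+ 2
  + \sum_j 'D_(e j) u z * 'D_(e j) (fun z => \sum_i 'D_(e i) ('D_(e i) u) z) z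
  + \sum_i 'D_(e i) ('D_(e i) V) z
  - \sum_i 'D_(e i) ('D_(e i) hamilton_jacobi_defect) z.
Proof.
have s1 v : smooth ('D_v u) by exact: smooth_derive.
have s2 v w : smooth ('D_w ('D_v u)) by exact: smooth_derive.
have sg := smooth_hamilton_jacobi_defect.
have utE : 'D_tau u = fun z => 2^-1 * (\sum_j 'D_(e j) u z * 'D_(e j) u z)
    + (V z - hamilton_jacobi_defect z).
  by apply/funext => y; rewrite /hamilton_jacobi_defect; ring.
have ut1 i : 'D_(e i) ('D_tau u) = fun z => \sum_j 'D_(e i) ('D_(e j) u) z * 'D_(e j) u z
    + ('D_(e i) V z - 'D_(e i) hamilton_jacobi_defect z).
  have sj j : smooth (fun z => 'D_(e j) u z * 'D_(e j) u z) by exact: smoothM.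
  apply/funext => y; rewrite utE.
  have D1 : derivable (fun z => 2^-1 * (\sum_j 'D_(e j) u z * 'D_(e j) u z)) y (e i).
    by apply: smooth_derivable; apply: smoothM; [exact: smooth_cst|exact: smooth_sum].
  have D2 : derivable (fun z => V z - hamilton_jacobi_defect z) y (e i).
    by apply: derivableB; exact: smooth_derivable.
  rewrite (deriveD D1 D2) deriveB; [|exact: smooth_derivable|exact: smooth_derivable].
  congr (_ + _); rewrite derive_smoothM; [|exact: smooth_cst|exact: smooth_sum].
  rewrite (derive_cst _ y) mul0r add0r derive_smooth_sum// mulr_sumr.
  by apply: eq_bigr => j _; rewrite derive_smoothM//; field.
have ut2 i : 'D_(e i) ('D_(e i) ('D_tau u)) z =
    \sum_j ('D_(e i) ('D_(e j) u) z ^+ 2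
            + 'D_(e j) u z * 'D_(e i) ('D_(e i) ('D_(e j) u)) z)
    + ('D_(e i) ('D_(e i) V) z - 'D_(e i) ('D_(e i) hamilton_jacobi_defect) z).
  have sj j : smooth (fun z => 'D_(e i) ('D_(e j) u) z * 'D_(e j) u z) by exact: smoothM.
  apply: etrans (eq_fun_derive _ _ (fun y => congr1 (@^~ y) (ut1 i))) _.
  have D1 : derivable (fun z => \sum_j 'D_(e i) ('D_(e j) u) z * 'D_(e j) u z) z (e i).
    by apply: smooth_derivable; exact: smooth_sum.
  have D2 : derivable (fun z => 'D_(e i) V z - 'D_(e i) hamilton_jacobi_defect z) z (e i).
    by apply: derivableB; apply: smooth_derivable; exact: smooth_derive.
  rewrite (deriveD D1 D2) deriveB;
    [|by apply: smooth_derivable; exact: smooth_derive..].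
  congr (_ + _); rewrite derive_smooth_sum//; apply: eq_bigr => j _.
  rewrite derive_smoothM; [|exact: smooth_derive|exact: s1].
  by rewrite addrC expr2; congr (_ + _); exact: mulrC.
rewrite derive_smooth_sum//.
(* Two exchanges of derivatives bring the one in [tau] innermost, where [ut2] applies. *)
apply: (@etrans _ _ (\sum_i 'D_(e i) ('D_(e i) ('D_tau u)) z)).
  apply: eq_bigr => i _; apply: etrans (derive_comm z (e i) tau (s1 (e i))) _.
  by apply: eq_fun_derive => y; exact: derive_comm.
apply: etrans (eq_bigr _ (fun i _ => ut2 i)) _.
rewrite big_split sumrB /= addrA; congr (_ + _ - _).
apply: etrans (eq_bigr _ (fun i _ => big_split _ _ _ _ _)) _.
(* Third derivatives are reordered so that, for fixed j, the sum over i is the derivative of the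
   Laplacian along [e j]. *)
rewrite big_split /=; congr (_ + _); rewrite exchange_big /=.
apply: eq_bigr => j _; rewrite -mulr_sumr; congr (_ * _).
apply: etrans _ (esym (derive_smooth_sum _ _ (fun i => s2 (e i) (e i)))).
apply: eq_bigr => i _.
apply: etrans (derive_comm z (e j) (e i) (s1 (e i))).
by apply: eq_fun_derive => y; exact: derive_comm.
Qed.

End time_derivative_of_laplacian.

(** At y = 0 monotonicity is known only to the right. A negative derivative would by continuity stay
    negative on some [y, y + e/2], and the mean value theorem would make [G] decrease there. *)
Lemma nondecreasing_derive_ge0 (R : realType) (G g : R -> R) (y : R) : smooth G ->
  (forall x, 0 <= x -> G x = g x) ->
  {in `[0, +oo[ &, {homo g : x y / x <= y}} -> 0 <= y -> 0 <= 'D_1 G y.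
Proof.
move=> sG Gg mono y0; rewrite leNgt; apply/negP => G'0.
have cG' : continuous ('D_1 G) by apply/smooth_continuous/smooth_derive.
have : \forall z \near y, 'D_1 G z < 0 by exact: (cvgr_lt _ (cG' y)).
move=> /nbhs_ballP[e /= e0 He].
have yz : y < y + e / 2 by rewrite ltrDl divr_gt0.
have [x _|x|x] := @MVT R G ('D_1 G) _ _ yz.
- by apply: derivableP; exact: smooth_derivable.
- by apply: continuous_subspaceT; exact: smooth_continuous.
rewrite in_itv /= => /andP[yx xz] E.
have : G y <= G (y + e / 2).
  rewrite !Gg//; last exact: ltW (le_lt_trans y0 yz).
  by apply: mono; rewrite ?in_itv /= ?andbT// ltW// (le_lt_trans y0).
rewrite -subr_ge0 E addrC addKr pmulr_lge0 ?divr_gt0// leNgt => /negP; apply.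
apply: He; rewrite -ball_normE /= ltr_distlC; apply/andP; split; lra.
Qed.

(** * The planning problem in terms of smooth extensions *)

Section planning_problem_extension.
Context {R : realType} {d : nat} (T : R) (V : R -> 'rV[R]_d -> R) (g : R -> R).
Variables (m0 mT : 'rV[R]_d -> R) (u m : R -> 'rV[R]_d -> R).

Lemma near_time (t : R) : 0 < t < T -> \forall s \near t, 0 <= s <= T.
Proof.
move=> t0T; have /near_in_itvoo[e /= e0 He] : t \in `]0, T[ by rewrite in_itv.
apply/nbhs_ballP; exists e => // s /He /=; rewrite in_itv /= => /andP[h1 h2].
by rewrite !ltW.
Qed.

Lemma derive1_extension (f : R -> 'rV[R]_d -> R) (F : R * 'rV[R]_d -> R) (t : R) x :
  smooth_periodic F -> (forall t, 0 <= t <= T -> f t = fun x => F (t, x)) ->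
  0 < t < T -> derive1 (fun s => f s x) t = 'D_time_dir F (t, x).
Proof.
move=> sF fF t0T; rewrite derive1E.
rewrite -(@derive_val _ _ _ _ _ _ _ (smooth_periodic_time t x sF)).
by apply: near_eq_derive; apply: filterS (near_time t0T) => s s0T; rewrite fF.
Qed.

(** The time derivative at an interior t depends only on nearby times, so the equations pass to the
    extensions for 0 < t < T. [G] may replace g because m >= 0. *)
Lemma planning_solution_extension :
  planning_data T V g m0 mT -> planning_solution T V g m0 mT u m ->
  exists (Fu Fm FV : R * 'rV[R]_d -> R) (G : R -> R),
    [/\ [/\ smooth_periodic Fu, smooth_periodic Fm, smooth_periodic FV & smooth G],
        forall t, 0 <= t <= T -> m t = (fun x => Fm (t, x)) /\ V t = (fun x => FV (t, x)),
        forall y, 0 <= y -> 0 <= 'D_1 G y,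
        forall t x, 0 < t < T ->
          hamilton_jacobi_defect space_dir time_dir Fu FV (t, x) = G (Fm (t, x))
      & forall t x, 0 < t < T -> 'D_time_dir Fm (t, x) =
          \sum_i ('D_(space_dir i) Fm (t, x) * 'D_(space_dir i) Fu (t, x) +
                  Fm (t, x) * 'D_(space_dir i) ('D_(space_dir i) Fu) (t, x))].
Proof.
move=> [/smooth_cylinder_extension[FV [sV VE]] [[G [sG Gg]] mono] _ _].
move=> [[/smooth_cylinder_extension[Fu [su uE]] /smooth_cylinder_extension[Fm [sm mE]]]].
move=> m_ge0 HJ CE _.
have t01 (t : R) : 0 < t < T -> 0 <= t <= T by move=> /andP[/ltW-> /ltW->].
exists Fu, Fm, FV, G; split=> //.
- by move=> t t0T; split; [exact: mE|exact: VE].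
- by move=> y; exact: (nondecreasing_derive_ge0 sG Gg mono).
- move=> t x t0T; have t0T' := t01 _ t0T.
  have := HJ t x t0T; rewrite (derive1_extension x su uE)//.
  have -> : sqnorm (gradient (u t) x) =
      \sum_i 'D_(space_dir i) Fu (t, x) * 'D_(space_dir i) Fu (t, x).
    apply: eq_bigr => i _; rewrite mxE uE//.
    by rewrite (partialE (smooth_periodic_partial t x i su)).
  have mx0 : 0 <= Fm (t, x) by have := m_ge0 t x t0T'; rewrite mE.
  rewrite mE// VE// -Gg// /hamilton_jacobi_defect => <-; ring.
- move=> t x t0T; have t0T' := t01 _ t0T.
  have := CE t x t0T; rewrite (derive1_extension x sm mE)// => /subr0_eq ->.
  apply: eq_bigr => i _; apply: partialE.
  have -> : (fun y => (m t y *: gradient (u t) y) 0 i) =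
      fun y => Fm (t, y) * 'D_(space_dir i) Fu (t, y).
    apply/funext => y; rewrite !mxE mE// uE//.
    by rewrite (partialE (smooth_periodic_partial t y i su)).
  apply: is_derive_mul; first exact: smooth_periodic_partial.
  exact: (smooth_periodic_partial t x i (smooth_periodic_derive (space_dir i) su)).
Qed.

End planning_problem_extension.

(** * The energy estimate for a general internal energy *)

Section energy_estimate.
Context {R : realType} {d : nat} (T : R) (Fu Fm FV : R * 'rV[R]_d -> R) (G : R -> R).
Hypotheses (T_gt0 : 0 < T) (su : smooth_periodic Fu) (sm : smooth_periodic Fm)
  (sV : smooth_periodic FV) (sG : smooth G).
Hypothesis m_ge0 : forall t x, 0 <= t <= T -> 0 <= Fm (t, x).
Hypothesis G'_ge0 : forall y, 0 <= y -> 0 <= 'D_1 G y.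
Hypothesis HJ : forall t x, 0 < t < T ->
  hamilton_jacobi_defect space_dir time_dir Fu FV (t, x) = G (Fm (t, x)).
Hypothesis CE : forall t x, 0 < t < T -> 'D_time_dir Fm (t, x) =
  \sum_i ('D_(space_dir i) Fm (t, x) * 'D_(space_dir i) Fu (t, x) +
          Fm (t, x) * 'D_(space_dir i) ('D_(space_dir i) Fu) (t, x)).

Variables (U U' P P' : R -> R) (p K : R).
Hypotheses (p_gt0 : 0 < p) (K_ge0 : 0 <= K).
Hypothesis dU : forall y : R, 0 <= y -> is_derive y 1 U (U' y).
Hypothesis cU' : forall y : R, 0 <= y -> {for y, continuous U'}.
Hypothesis PE : forall y : R, 0 <= y -> y * U' y - U y = P y.
Hypothesis dP : forall y : R, 0 <= y -> is_derive y 1 P (P' y).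
Hypothesis cP' : forall y : R, 0 <= y -> {for y, continuous P'}.
Hypothesis P'_ge0 : forall y : R, 0 <= y -> 0 <= P' y.
Hypothesis PU : forall y : R, 0 <= y -> `|P y| <= p * U y.
Hypothesis matP : forall (y : R) (A : 'I_d -> 'I_d -> R), 0 <= y ->
  0 <= (y * P' y - P y) * (\sum_i A i i) ^+ 2 + P y * \sum_i \sum_j A i j ^+ 2.
Hypothesis lapV : forall t x, 0 <= t <= T ->
  `|\sum_i 'D_(space_dir i) ('D_(space_dir i) FV) (t, x)| <= K.
Hypothesis pKT : K * p * T ^+ 2 / 2 < 1.

Let Lap z := \sum_i 'D_(space_dir i) ('D_(space_dir i) Fu) z.

Let sLap : smooth_periodic Lap.
Proof. by apply: smooth_periodic_sum => i; do 2 apply: smooth_periodic_derive. Qed.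

Let U_ge0 y : 0 <= y -> 0 <= U y.
Proof. by move=> /PU /(le_trans (normr_ge0 _)); rewrite pmulr_rge0. Qed.

Let continuous_comp_m (Q : R -> R) t x :
  {for Fm (t, x), continuous Q} -> {for (t, x), continuous (fun z => Q (Fm z))}.
Proof. by move=> cQ; apply: continuous_comp => //; exact: smooth_periodic_continuous. Qed.

Let derivable_cont (Q Q' : R -> R) (y : R) : is_derive y 1 Q (Q' y) ->
  {for y, continuous Q}.
Proof. by move=> [dQ _]; exact/differentiable_continuous/derivable1_diffP. Qed.

(** [f1] and [h1] are the time derivatives of [f0] and [h0]. By the first variation [f1] and [h0]
    have equal integrals, so the integral of [h1] is the second derivative of the energy, and U' is
    never differentiated. *)
Let f0 t x := U (Fm (t, x)).
Let f1 t x := U' (Fm (t, x)) * 'D_time_dir Fm (t, x).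
Let h0 t x := P (Fm (t, x)) * Lap (t, x).
Let h1 t x := P' (Fm (t, x)) * 'D_time_dir Fm (t, x) * Lap (t, x)
  + P (Fm (t, x)) * 'D_time_dir Lap (t, x).

Let pf0 t : 0 <= t <= T -> Defs.periodic (f0 t).
Proof. by move=> _ x i; rewrite /f0; congr U; exact: (smooth_periodic_slice t sm x i). Qed.

Let pf1 t : 0 <= t <= T -> Defs.periodic (f1 t).
Proof.
move=> _ x i; rewrite /f1; congr (U' _ * _); first exact: (smooth_periodic_slice t sm x i).
exact: (smooth_periodic_slice t (smooth_periodic_derive time_dir sm) x i).
Qed.

Let ph0 t : 0 <= t <= T -> Defs.periodic (h0 t).
Proof.
move=> _ x i; rewrite /h0; congr (P _ * _); first exact: (smooth_periodic_slice t sm x i).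
exact: (smooth_periodic_slice t sLap x i).
Qed.

Let ph1 t : 0 <= t <= T -> Defs.periodic (h1 t).
Proof.
move=> _ x i; have E := smooth_periodic_slice t sm x i.
have E1 := smooth_periodic_slice t (smooth_periodic_derive time_dir sm) x i.
have E2 := smooth_periodic_slice t sLap x i.
have E3 := smooth_periodic_slice t (smooth_periodic_derive time_dir sLap) x i.
exact: (f_equal2 +%R (f_equal2 *%R (f_equal2 *%R (f_equal P' E) E1) E2)
  (f_equal2 *%R (f_equal P E) E3)).
Qed.

Let cf0 t x : 0 <= t <= T -> {for (t, x), continuous (fun z => f0 z.1 z.2)}.
Proof.
move=> t0T; have -> : (fun z => f0 z.1 z.2) = fun z => U (Fm z).
  by apply/funext => -[].
by apply: continuous_comp_m; apply: (derivable_cont (dU _)); exact: m_ge0.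
Qed.

Let cf1 t x : 0 <= t <= T -> {for (t, x), continuous (fun z => f1 z.1 z.2)}.
Proof.
move=> t0T; have -> : (fun z => f1 z.1 z.2) = (fun z => U' (Fm z)) * 'D_time_dir Fm.
  by apply/funext => -[].
apply: continuousM; first by apply: continuous_comp_m; apply: cU'; exact: m_ge0.
exact: (smooth_periodic_continuous (smooth_periodic_derive time_dir sm)).
Qed.

Let cP_m t x : 0 <= t <= T -> {for (t, x), continuous (fun z => P (Fm z))}.
Proof.
by move=> t0T; apply: continuous_comp_m; apply: (derivable_cont (dP _)); exact: m_ge0.
Qed.

Let ch0 t x : 0 <= t <= T -> {for (t, x), continuous (fun z => h0 z.1 z.2)}.
Proof.
move=> t0T; have -> : (fun z => h0 z.1 z.2) = (fun z => P (Fm z)) * Lap.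
  by apply/funext => -[].
by apply: continuousM; [exact: cP_m|exact: (smooth_periodic_continuous sLap)].
Qed.

Let ch1 t x : 0 <= t <= T -> {for (t, x), continuous (fun z => h1 z.1 z.2)}.
Proof.
move=> t0T; have -> : (fun z => h1 z.1 z.2) =
    (fun z => P' (Fm z)) * 'D_time_dir Fm * Lap + (fun z => P (Fm z)) * 'D_time_dir Lap.
  by apply/funext => -[].
apply: continuousD; apply: continuousM.
- apply: continuousM; first by apply: continuous_comp_m; apply: cP'; exact: m_ge0.
  exact: (smooth_periodic_continuous (smooth_periodic_derive time_dir sm)).
- exact: (smooth_periodic_continuous sLap).
- exact: cP_m.
- exact: (smooth_periodic_continuous (smooth_periodic_derive time_dir sLap)).
Qed.

Let interior (t : R) : 0 < t < T -> 0 <= t <= T.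
Proof. by move=> /andP[/ltW-> /ltW->]. Qed.

Let df0 (t : R) x : 0 < t < T -> is_derive t 1 (f0 ^~ x) (f1 t x).
Proof.
move=> t0T; apply: is_derive_comp1; first by apply: dU; exact/m_ge0/interior.
exact: smooth_periodic_time.
Qed.

Let dh0 (t : R) x : 0 < t < T -> is_derive t 1 (h0 ^~ x) (h1 t x).
Proof.
move=> t0T; have dm : is_derive t 1 (fun s => P (Fm (s, x)))
    (P' (Fm (t, x)) * 'D_time_dir Fm (t, x)).
  apply: is_derive_comp1; first by apply: dP; exact/m_ge0/interior.
  exact: smooth_periodic_time.
have dL := smooth_periodic_time t x sLap.
rewrite (_ : h1 t x = P (Fm (t, x)) *: 'D_time_dir Lap (t, x)
  + Lap (t, x) *: (P' (Fm (t, x)) * 'D_time_dir Fm (t, x))).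
  exact: (is_deriveM dm dL).
by rewrite /h1 /GRing.scale /= addrC (mulrC (Lap _)).
Qed.

Let a t i (x : 'rV[R]_d) := 'D_(space_dir i) Fu (t, x).

Let Ca t i : torus_C1 (a t i).
Proof. exact: (smooth_periodic_C1 t (smooth_periodic_derive (space_dir i) su)). Qed.

Let paE t i j x : partial i (a t j) x = 'D_(space_dir i) ('D_(space_dir j) Fu) (t, x).
Proof.
exact: (partialE (smooth_periodic_partial t x i (smooth_periodic_derive (space_dir j) su))).
Qed.

Let pmE t i x : partial i (fun y => Fm (t, y)) x = 'D_(space_dir i) Fm (t, x).
Proof. exact: (partialE (smooth_periodic_partial t x i sm)). Qed.

Let LapE t x : Lap (t, x) = \sum_i partial i (a t i) x.
Proof. by apply: eq_bigr => i _; rewrite paE. Qed.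

Let time_derivative_m t x : 0 < t < T -> 'D_time_dir Fm (t, x) =
  \sum_i (partial i (fun y => Fm (t, y)) x * a t i x
          + Fm (t, x) * partial i (a t i) x).
Proof.
move=> t0T; apply: etrans (CE x t0T) _; apply: eq_bigr => i _.
exact: (f_equal2 +%R (f_equal2 *%R (esym (pmE t i x)) erefl)
  (f_equal2 *%R erefl (esym (paE t i i x)))).
Qed.

Let energy_derivative (t : R) : 0 < t < T ->
  is_derive t 1 (fun s => torus_integral (f0 s)) (torus_integral (h0 t)).
Proof.
move=> t0T; have t0T' := interior t0T.
have := is_derive_torus_integral pf0 pf1 cf0 cf1 df0 t0T.
suff -> : torus_integral (f1 t) = torus_integral (h0 t) by [].
have E := energy_first_variation (smooth_periodic_C1 t sm) (Ca t)
  (fun x => dU (m_ge0 x t0T')) (fun x => cU' (m_ge0 x t0T')).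
apply: etrans (etrans _ E) _; apply: eq_torus_integral => x.
  by rewrite /f1 time_derivative_m.
exact: (f_equal2 *%R (PE (m_ge0 x t0T')) (esym (LapE t x))).
Qed.

Let energy_second_derivative_ge (t : R) : 0 < t < T ->
  - (K * p * torus_integral (f0 t)) <= torus_integral (h1 t).
Proof.
move=> t0T; have t0T' := interior t0T.
pose gam := hamilton_jacobi_defect space_dir time_dir Fu FV.
have sgam : smooth_periodic gam.
  apply: smooth_periodicD; last exact/smooth_periodicN/smooth_periodic_derive.
  apply: smooth_periodicD => //; apply: smooth_periodicM; first exact: smooth_periodic_cst.
  by apply: smooth_periodic_sum => i; apply: smooth_periodicM; exact: smooth_periodic_derive.
pose gamma i x := 'D_(space_dir i) gam (t, x).
have Cgamma i : torus_C1 (gamma i).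
  exact: (smooth_periodic_C1 t (smooth_periodic_derive (space_dir i) sgam)).
have gammaE i x : gamma i x = 'D_1 G (Fm (t, x)) * partial i (fun y => Fm (t, y)) x.
  rewrite /gamma -(partialE (smooth_periodic_partial t x i sgam)).
  (* At a fixed interior time the first equation holds for all space points, so it may be
     differentiated in space. *)
  have -> : (fun y => gam (t, y)) = fun y => G (Fm (t, y)).
    by apply/funext => y; exact: HJ.
  apply: partialE; apply: is_derive_comp1.
    by apply: derivableP; exact: smooth_derivable.
  by rewrite pmE; exact: smooth_periodic_partial.
have CLap : torus_C1 (fun x => \sum_i partial i (a t i) x).
  have <- : (fun x => Lap (t, x)) = fun x => \sum_i partial i (a t i) x.
    by apply/funext => x; exact: LapE.
  exact: smooth_periodic_C1.
have th1 : torus_continuous (h1 t).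
  by apply: slice_torus_continuous; [exact: ph1|move=> x; exact: ch1].
have tf0 : torus_continuous (f0 t).
  by apply: slice_torus_continuous; [exact: pf0|move=> x; exact: cf0].
(* The second equation replaces the time derivative of m, and the Bochner formula that of Lap u; the
   result is the integrand of the second variation. *)
have h1E : h1 t = fun x => P' (Fm (t, x)) *
    (\sum_i (partial i (fun y => Fm (t, y)) x * a t i x + Fm (t, x) * partial i (a t i) x))
      * (\sum_i partial i (a t i) x)
    + P (Fm (t, x)) * (\sum_i \sum_j partial i (a t j) x ^+ 2
      + \sum_i a t i x * partial i (fun x => \sum_i partial i (a t i) x) x
      + \sum_i 'D_(space_dir i) ('D_(space_dir i) FV) (t, x)
      - \sum_i partial i (gamma i) x).
  apply/funext => x; apply: (f_equal2 +%R).
    exact: (f_equal2 *%R (f_equal2 *%R erefl (time_derivative_m x t0T)) (LapE t x)).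
  apply: (f_equal2 *%R erefl).
  apply: etrans (derive_time_laplacian space_dir time_dir (proj1 su) (proj1 sV) (t, x)) _.
  have Q1 : \sum_i \sum_j 'D_(space_dir i) ('D_(space_dir j) Fu) (t, x) ^+ 2 =
      \sum_i \sum_j partial i (a t j) x ^+ 2.
    by apply: eq_bigr => i _; apply: eq_bigr => j _;
      exact: (f_equal (fun r => r ^+ 2) (esym (paE t i j x))).
  have Q2 : \sum_i 'D_(space_dir i) Fu (t, x) * 'D_(space_dir i) Lap (t, x) =
      \sum_i a t i x * partial i (fun x => \sum_i partial i (a t i) x) x.
    apply: eq_bigr => i _; apply: (f_equal2 *%R erefl).
    have <- : (fun x => Lap (t, x)) = fun x => \sum_i partial i (a t i) x.
      by apply/funext => y; exact: LapE.
    exact: (esym (partialE (smooth_periodic_partial t x i sLap))).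
  have Q3 : \sum_i 'D_(space_dir i) ('D_(space_dir i) gam) (t, x) =
      \sum_i partial i (gamma i) x.
    apply: eq_bigr => i _.
    exact: (esym (partialE (smooth_periodic_partial t x i
      (smooth_periodic_derive (space_dir i) sgam)))).
  exact: (f_equal2 +%R (f_equal2 +%R (f_equal2 +%R Q1 Q2) erefl) (f_equal -%R Q3)).
rewrite h1E in th1 *.
apply: (energy_second_variation_ge (smooth_periodic_C1 t sm) (Ca t) CLap Cgamma gammaE
  _ _ dP cP' P'_ge0 PU matP _ tf0 th1).
- by move=> x; apply/G'_ge0/m_ge0.
- by move=> x; exact: m_ge0.
- by move=> x; exact: lapV.
Qed.

Lemma energy_estimate (A : R) :
  torus_integral (fun x => U (Fm (0, x))) <= A ->
  torus_integral (fun x => U (Fm (T, x))) <= A ->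
  forall t, 0 <= t <= T ->
    torus_integral (fun x => U (Fm (t, x))) <= A / (1 - K * p * T ^+ 2 / 2).
Proof.
move=> A0 AT.
apply: (@semiconvex_max_le _ (fun t => torus_integral (f0 t))
  (fun t => torus_integral (h0 t)) (fun t => torus_integral (h1 t)) T (K * p) A) => //.
- by rewrite mulr_ge0// ltW.
- exact: within_continuous_torus_integral pf0 pf1 cf0 cf1 df0.
- by move=> t t0T; exact: (is_derive_torus_integral ph0 ph1 ch0 ch1 dh0 t0T).
- move=> t t0T; rewrite -(@torus_integral_cst R d 0); apply: le_torus_integral.
  + exact: torus_continuous_cst.
  + by apply: slice_torus_continuous; [exact: pf0|move=> x; exact: cf0].
  + by move=> x; apply: U_ge0; exact: m_ge0.
Qed.

End energy_estimate.

(** * Power energies *)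

Section shifted_powers.
Context {R : realType}.
Implicit Types (y e s p : R).

Lemma is_derive_shifted_powR e s y : 0 < y + e ->
  is_derive y 1 (fun z => (z + e) `^ s) (s * (y + e) `^ (s - 1)).
Proof.
move=> ye; have H := @is_derive1_powR R s (y + e) ye.
have Hs : is_derive y 1 (fun z : R => z + e) 1.
  by apply: is_derive_eq; rewrite addr0.
have := @is_derive1_comp R (fun z => z `^ s) (fun z => z + e) y _ _ H Hs.
by rewrite mulr1.
Qed.

Lemma continuous_shifted_powR e s y : 0 < y + e ->
  {for y, continuous (fun z => (z + e) `^ s)}.
Proof.
move=> ye; apply/differentiable_continuous/derivable1_diffP.
by have [] := is_derive_shifted_powR s ye.
Qed.

(** Brings the powers in an inequality down to a common lowest one, a positive factor, so that only
    polynomial algebra remains. *)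
Lemma shifted_powR_pred e s y : 0 < y + e ->
  (y + e) `^ s = (y + e) * (y + e) `^ (s - 1).
Proof.
move=> ye; have := @powRD R (y + e) 1 (s - 1).
by rewrite (gt_eqF ye) implybT [1 + _]addrC subrK powRr1 ?ltW// => /(_ isT).
Qed.

End shifted_powers.

Section internal_energies.
Context {R : realType} {d : nat} (T : R) (V : R -> 'rV[R]_d -> R) (g : R -> R).
Variables (m0 mT : 'rV[R]_d -> R) (u m : R -> 'rV[R]_d -> R) (K p : R).
Hypotheses (T_gt0 : 0 < T) (data : planning_data T V g m0 mT)
  (sol : planning_solution T V g m0 mT u m).
Hypotheses (K_ge0 : 0 <= K)
  (lapV : (cylinder_Linfty T (fun t => laplacian (V t)) <= K%:E)%E)
  (pKT : K * p * T ^+ 2 / 2 < 1).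

Lemma solution_torus_continuous t : 0 <= t <= T -> torus_continuous (m t).
Proof.
have [Fu [Fm [FV [G [[_ sm _ _] mE _ _ _]]]]] := planning_solution_extension data sol.
by move=> /mE[-> _]; exact/torus_C1_continuous/smooth_periodic_C1.
Qed.

Lemma solution_ge0 t x : 0 <= t <= T -> 0 <= m t x.
Proof. by case: sol => _ + _ _ _; exact. Qed.

(** All conditions on the energy concern functions of one real variable, and [A] sees only m0 and
    mT. Hence the bound is the same for every solution. *)
Lemma internal_energy_bound (U U' P P' : R -> R) (A : R) : 0 < p ->
  (forall y : R, 0 <= y -> is_derive y 1 U (U' y)) ->
  (forall y : R, 0 <= y -> {for y, continuous U'}) ->
  (forall y : R, 0 <= y -> y * U' y - U y = P y) ->
  (forall y : R, 0 <= y -> is_derive y 1 P (P' y)) ->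
  (forall y : R, 0 <= y -> {for y, continuous P'}) ->
  (forall y : R, 0 <= y -> 0 <= P' y) ->
  (forall y : R, 0 <= y -> `|P y| <= p * U y) ->
  (forall (y : R) (A : 'I_d -> 'I_d -> R), 0 <= y ->
    0 <= (y * P' y - P y) * (\sum_i A i i) ^+ 2 + P y * \sum_i \sum_j A i j ^+ 2) ->
  torus_integral (fun x => U (m0 x)) <= A ->
  torus_integral (fun x => U (mT x)) <= A ->
  forall t, 0 <= t <= T ->
    torus_integral (fun x => U (m t x)) <= A / (1 - K * p * T ^+ 2 / 2).
Proof.
move=> p0 dU cU' PE dP cP' P'0 PU matP A0 AT t t0T.
have [Fu [Fm [FV [G [[su sm sV sG] mE G'0 HJ CE]]]]] := planning_solution_extension data sol.
have [_ _ _ _ bc] := sol.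
have mE' s x : 0 <= s <= T -> m s x = Fm (s, x) by move=> /mE[-> _].
have Fm0 s x : 0 <= s <= T -> 0 <= Fm (s, x) by move=> s0T; rewrite -mE' ?solution_ge0.
have sL : smooth_periodic (fun z => \sum_i 'D_(space_dir i) ('D_(space_dir i) FV) z).
  by apply: smooth_periodic_sum => i; do 2 apply: smooth_periodic_derive.
have lapVF s x : 0 <= s <= T ->
    `|\sum_i 'D_(space_dir i) ('D_(space_dir i) FV) (s, x)| <= K.
  apply: (cylinder_Linfty_bound (F := fun s x =>
    \sum_i 'D_(space_dir i) ('D_(space_dir i) FV) (s, x)) T_gt0 _ _ _ lapV).
  - by move=> r y /mE[_ VE]; rewrite (laplacian_slice sV VE).
  - by move=> r _; exact: (smooth_periodic_slice r sL).
  - move=> r y _; rewrite (_ : (fun z => _) =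
      (fun z => \sum_i 'D_(space_dir i) ('D_(space_dir i) FV) z)).
      exact: (smooth_periodic_continuous sL).
    by apply/funext => -[].
have z0T : 0 <= (0 : R) <= T by rewrite lexx (ltW T_gt0).
have TT : 0 <= T <= T by rewrite (ltW T_gt0) /=.
rewrite (eq_torus_integral (g := fun x => U (Fm (t, x)))); last by move=> x; rewrite mE'.
apply: (energy_estimate T_gt0 su sm sV sG Fm0 G'0 HJ CE p0 K_ge0 dU cU' PE dP cP' P'0 PU
  matP lapVF pKT _ _ t0T).
- apply: le_trans A0; rewrite le_eqVlt; apply/orP; left; apply/eqP.
  by apply: eq_torus_integral => x; rewrite -mE' ?(bc x).1.
- apply: le_trans AT; rewrite le_eqVlt; apply/orP; left; apply/eqP.
  by apply: eq_torus_integral => x; rewrite -mE' ?(bc x).2.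
Qed.

(** The factor y makes P(y) = p y^2 (y+1)^(p-1) nonnegative, whereas (y+1)^(p+1) would give P(0) =
    -1 and spoil the matrix inequality when d >= 2. The shift by 1 makes the power differentiable
    from both sides at y = 0, since m may vanish. *)
Lemma power_energy_bound (A : R) : 0 < p ->
  torus_integral (fun x => m0 x * (m0 x + 1) `^ p) <= A ->
  torus_integral (fun x => mT x * (mT x + 1) `^ p) <= A ->
  forall t, 0 <= t <= T ->
    torus_integral (fun x => m t x * (m t x + 1) `^ p) <= A / (1 - K * p * T ^+ 2 / 2).
Proof.
move=> p0; pose q s (y : R) := (y + 1) `^ s.
have y1 (y : R) : 0 <= y -> 0 < y + 1 by move=> y0; rewrite ltr_wpDl.
have dq s (y : R) : 0 <= y -> is_derive y 1 (q s) (s * q (s - 1) y).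
  by move=> y0; apply: is_derive_shifted_powR; exact: y1.
have cq s (y : R) : 0 <= y -> {for y, continuous (q s)}.
  by move=> y0; apply: continuous_shifted_powR; exact: y1.
have qE s (y : R) : 0 <= y -> q s y = (y + 1) * q (s - 1) y.
  by move=> y0; apply: shifted_powR_pred; exact: y1.
have q0 s (y : R) : 0 <= y -> 0 < q s y by move=> y0; rewrite powR_gt0 ?y1.
apply: (internal_energy_bound
  (U := fun y => y * q p y)
  (U' := fun y => q p y + y * (p * q (p - 1) y))
  (P := fun y => p * y ^+ 2 * q (p - 1) y)
  (P' := fun y => p * (2 * y) * q (p - 1) y + p * y ^+ 2 * ((p - 1) * q (p - 1 - 1) y))
  p0).
- move=> y y0; have H := dq p y y0.
  have -> : (fun y => y * (y + 1) `^ p) = id * q p by [].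
  by apply: is_derive_eq; rewrite /GRing.scale /=; ring.
- move=> y y0; apply: (@continuousD _ _ _ (q p)); first exact: cq.
  apply: (@continuousM _ _ id); first exact: cvg_id.
  by apply: (@continuousM _ _ (fun=> p)); [exact: cst_continuous|exact: cq].
- by move=> y y0; rewrite -/(q p y); ring.
- move=> y y0; have H := dq (p - 1) y y0.
  have -> : (fun y => p * y ^+ 2 * q (p - 1) y) = (fun y => p * y ^+ 2) * q (p - 1) by [].
  by apply: is_derive_eq; rewrite /GRing.scale /=; ring.
- move=> y y0.
  have cid : {for y, continuous (@id R)} by exact: cvg_id.
  have cc c : {for y, continuous (fun=> c : R)} by exact: cst_continuous.
  have c1 : {for y, continuous (fun z : R => p * (2 * z))}.
    by apply: (@continuousM _ _ (fun=> p)) => //; exact: (@continuousM _ _ (fun=> 2) id).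
  have c2 : {for y, continuous (fun z : R => p * z ^+ 2)}.
    by apply: (@continuousM _ _ (fun=> p)) => //; exact: (@continuousM _ _ id id).
  have c3 : {for y, continuous (fun z : R => (p - 1) * q (p - 1 - 1) z)}.
    by apply: (@continuousM _ _ (fun=> p - 1)) => //; exact: cq.
  exact: (continuousD (continuousM c1 (cq (p - 1) y y0)) (continuousM c2 c3)).
- move=> y y0; rewrite (qE (p - 1))//.
  have := q0 (p - 1 - 1) y y0; set r := q _ y => r0.
  have -> : p * (2 * y) * ((y + 1) * r) + p * y ^+ 2 * ((p - 1) * r)
    = p * y * r * (2 + y * (p + 1)) by ring.
  by rewrite !mulr_ge0 ?(ltW p0) ?(ltW r0)// addr_ge0// mulr_ge0// addr_ge0// ltW.
- move=> y y0; rewrite -/(q p y) (qE p)//.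
  have := q0 (p - 1) y y0; set r := q _ y => r0.
  rewrite ger0_norm; last by rewrite !mulr_ge0 ?(ltW p0) ?(ltW r0)// sqr_ge0.
  rewrite -subr_ge0 (_ : _ - _ = p * y * r); last by ring.
  by rewrite !mulr_ge0 ?(ltW p0) ?(ltW r0).
- move=> y B y0; have := q0 (p - 1 - 1) y y0; rewrite (qE (p - 1))//.
  set r := q _ y => r0.
  apply: addr_ge0; apply: mulr_ge0.
  (* Both coefficients of the quadratic form are nonnegative, so no relation between the trace and
     the full matrix is used. *)
  + have -> : y * (p * (2 * y) * ((y + 1) * r) + p * y ^+ 2 * ((p - 1) * r))
      - p * y ^+ 2 * ((y + 1) * r) = p * y ^+ 2 * r * (1 + p * y) by ring.
    by rewrite !mulr_ge0 ?sqr_ge0 ?(ltW p0) ?(ltW r0)// addr_ge0// mulr_ge0// ltW.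
  + exact: sqr_ge0.
  + by rewrite !mulr_ge0 ?sqr_ge0 ?(ltW p0) ?(ltW r0)// addr_ge0.
  + by apply: sumr_ge0 => i _; apply: sumr_ge0 => j _; exact: sqr_ge0.
Qed.

End internal_energies.

Section negative_power_energy.
Context {R : realType} (T : R) (V : R -> 'rV[R]_1 -> R) (g : R -> R).
Variables (m0 mT : 'rV[R]_1 -> R) (u m : R -> 'rV[R]_1 -> R) (K p : R).
Hypotheses (T_gt0 : 0 < T) (data : planning_data T V g m0 mT)
  (sol : planning_solution T V g m0 mT u m).
Hypotheses (K_ge0 : 0 <= K)
  (lapV : (cylinder_Linfty T (fun t => laplacian (V t)) <= K%:E)%E)
  (pKT : K * p * T ^+ 2 / 2 < 1).

(** Here P(y) = - (p y + e) (y+e)^(-p) and P'(y) = p (p-1) y (y+e)^(-p-1). The factor multiplying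
    [A] is independent of [e], which allows the shift to be removed afterwards. *)
Lemma negative_power_energy_bound (e A : R) : 1 <= p -> 0 < e ->
  torus_integral (fun x => (m0 x + e) `^ (1 - p)) <= A ->
  torus_integral (fun x => (mT x + e) `^ (1 - p)) <= A ->
  forall t, 0 <= t <= T ->
    torus_integral (fun x => (m t x + e) `^ (1 - p)) <= A / (1 - K * p * T ^+ 2 / 2).
Proof.
move=> p1 e0; pose q s (y : R) := (y + e) `^ s.
have p0 : 0 < p by rewrite (lt_le_trans ltr01).
have ye (y : R) : 0 <= y -> 0 < y + e by move=> y0; rewrite ltr_wpDl.
have dq s (y : R) : 0 <= y -> is_derive y 1 (q s) (s * q (s - 1) y).
  by move=> y0; apply: is_derive_shifted_powR; exact: ye.
have cq s (y : R) : 0 <= y -> {for y, continuous (q s)}.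
  by move=> y0; apply: continuous_shifted_powR; exact: ye.
have qE s (y : R) : 0 <= y -> q s y = (y + e) * q (s - 1) y.
  by move=> y0; apply: shifted_powR_pred; exact: ye.
have q0 s (y : R) : 0 <= y -> 0 < q s y by move=> y0; rewrite powR_gt0 ?ye.
have pE : 1 - p - 1 = - p by ring.
apply: (internal_energy_bound T_gt0 data sol K_ge0 lapV pKT
  (U := q (1 - p)) (U' := fun y => (1 - p) * q (- p) y)
  (P := fun y => - (p * y + e) * q (- p) y)
  (P' := fun y => p * (p - 1) * y * q (- p - 1) y)
  p0).
- by move=> y y0; have := dq (1 - p) y y0; rewrite pE.
- by move=> y y0; apply: (@continuousM _ _ (fun=> 1 - p)); [exact: cst_continuous|exact: cq].
- by move=> y y0; rewrite (qE (1 - p))// pE; ring.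
- move=> y y0; have H := dq (- p) y y0.
  have -> : (fun y => - (p * y + e) * q (- p) y) = (fun y => - (p * y + e)) * q (- p) by [].
  by apply: is_derive_eq; rewrite /GRing.scale /= (qE (- p))//; ring.
- move=> y y0; apply: continuousM; last exact: cq.
  by apply: (@continuousM _ _ (fun=> p * (p - 1)) id); [exact: cst_continuous|exact: cvg_id].
- by move=> y y0; rewrite !mulr_ge0 ?subr_ge0 ?(ltW p0) ?(ltW (q0 _ _ y0)).
- move=> y y0; rewrite (qE (1 - p))// pE.
  have := q0 (- p) y y0; set r := q _ y => r0.
  rewrite mulNr normrN ger0_norm; last first.
    by rewrite mulr_ge0 ?(ltW r0)// addr_ge0 ?(ltW e0)// mulr_ge0 ?(ltW p0).
  (* The shift costs nothing in the constant p exactly because p >= 1. *)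
  rewrite -subr_ge0 (_ : _ - _ = (p - 1) * e * r); last by ring.
  by rewrite !mulr_ge0 ?subr_ge0 ?(ltW e0) ?(ltW r0).
- move=> y B y0; rewrite !big_ord1.
  (* For a matrix of size one, squared trace and squared norm agree, and the negative P cancels. *)
  rewrite (_ : _ + _ = y * (p * (p - 1) * y * q (- p - 1) y) * B ord0 ord0 ^+ 2); last by ring.
  apply: mulr_ge0; last exact: sqr_ge0.
  by rewrite !mulr_ge0 ?subr_ge0 ?(ltW p0) ?(ltW (q0 _ _ y0)).
Qed.

End negative_power_energy.

(** * From integral bounds to norms, and removal of the shift *)

Section Lnorm_bounds.
Context {R : realType}.

Lemma torus_Lnorm_le d (q C : R) (f : 'rV[R]_d -> \bar R) : 0 < q ->
  (\int[torus_measure d]_x (`|f (Defs.point x)| `^ q) <= C%:E)%E ->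
  (torus_Lnorm q f <= (C `^ q^-1)%:E)%E.
Proof.
move=> q0 fC; rewrite /torus_Lnorm unlock -poweR_EFin.
have I0 : (0 <= \int[torus_measure d]_x (`|f (Defs.point x)| `^ q))%E.
  by apply: integral_ge0 => x _; exact: poweR_ge0.
apply: gt0_ler_poweR => //; first by rewrite invr_ge0 ltW.
- by rewrite in_itv /= leey andbT.
- by rewrite in_itv /= leey andbT (le_trans I0).
Qed.

(** The norm is nonnegative and below a real number, hence real: it is itself the witness K. The
    strict inequality is what keeps 1 - K p T^2 / 2 positive. *)
Lemma cylinder_Linfty_gap d (T p : R) (f : R -> 'rV[R]_d -> R) : 0 < T -> 0 < p ->
  (cylinder_Linfty T f < (2 / T ^+ 2 * p^-1)%:E)%E ->
  exists K, [/\ 0 <= K, (cylinder_Linfty T f <= K%:E)%E & K * p * T ^+ 2 / 2 < 1].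
Proof.
move=> T0 p0; have := Lnorm_ge0 (cylinder_measure d T) +oo
  (fun z => (f z.1 (Defs.point z.2))%:E).
rewrite -/(cylinder_Linfty T f); case: (cylinder_Linfty T f) => // K.
rewrite lee_fin lte_fin => K0 KT; exists K; split=> //.
rewrite (_ : 2 / T ^+ 2 * p^-1 = 2 / (p * T ^+ 2)) in KT; last first.
  by rewrite [(p * _)^-1]invfM -mulrA (mulrC p^-1).
by rewrite ltr_pdivrMr// mul1r -mulrA -ltr_pdivlMr// mulr_gt0// exprn_gt0.
Qed.

Lemma ler_negative_powR (k y q : R) : 0 < k -> k <= y -> 0 <= q ->
  y `^ (- q) <= k `^ (- q).
Proof.
move=> k0 ky q0; have y0 := lt_le_trans k0 ky.
rewrite !powRN lef_pV2 ?posrE ?powR_gt0//.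
by apply: ge0_ler_powR; rewrite ?nnegrE ?(ltW k0) ?(ltW y0).
Qed.

Lemma cvg_shifted_negative_powR (y q : R) : 0 <= y -> 1 <= q ->
  ((y + n.+1%:R^-1) `^ (- q))%:E @[n --> \oo] --> (`|y%:E^-1| `^ q)%E.
Proof.
move=> y0 q1; have q0 : 0 < q by rewrite (lt_le_trans ltr01).
have invE (z : R) : 0 < z -> z^-1 `^ q = z `^ (- q).
  by move=> z0; rewrite -powR_inv1 ?ltW// -powRrM mulN1r.
rewrite inver; case: eqVneq => [->|yn0].
  (* At y = 0 the limit is +oo: the terms are (n+1)^q, which dominate n since q >= 1. *)
  rewrite (_ : `|+oo| = +oo)%E// poweRyr ?gt_eqF//; apply/cvgeryP.
  apply: (@ger_cvgy _ _ _ _ (fun n => n%:R)); last exact: cvgr_idn.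
  apply: nearW => n; rewrite add0r -invE ?invr_gt0// invrK.
  apply: le_trans (le1r_powR _ q1); last by rewrite ler1n.
  by rewrite ler_nat.
have {}y0 : 0 < y by rewrite lt_neqAle eq_sym yn0.
rewrite abse_EFin poweR_EFin gtr0_norm ?invr_gt0// invE//.
apply: cvg_EFin; first exact: nearW.
have c : (z + y) `^ (- q) @[z --> (0 : R)] --> (0 + y) `^ (- q).
  by apply: (@continuous_shifted_powR R y (- q) 0); rewrite add0r.
rewrite add0r in c.
under eq_fun do rewrite /= addrC.
by apply: (cvg_comp _ _ _ c); exact: cvg_harmonic.
Qed.

(** Monotone convergence along the shifts 1/(n+1). Zeros of f are allowed: there the integrand is
    +oo, and the finite bound makes them negligible. *)
Lemma integral_inverse_power_le d (f : 'rV[R]_d -> R) (q C : R) :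
  torus_continuous f -> (forall x, 0 <= f x) -> 1 <= q ->
  (forall e, 0 < e -> torus_integral (fun x => (f x + e) `^ (- q)) <= C) ->
  (\int[torus_measure d]_x (`|(f (Defs.point x))%:E^-1| `^ q) <= C%:E)%E.
Proof.
move=> tf f0 q1 fC; have q0 : 0 < q by rewrite (lt_le_trans ltr01).
pose h n (x : d.-tuple (measurableTypeR R)) : \bar R :=
  ((f (Defs.point x) + n.+1%:R^-1) `^ (- q))%:E.
have fe n x : 0 < f x + n.+1%:R^-1 by rewrite ltr_wpDl ?invr_gt0.
have th n : torus_continuous (fun x => (f x + n.+1%:R^-1) `^ (- q)).
  apply: (torus_continuous_comp (G := fun z => (z + n.+1%:R^-1) `^ (- q))) => // x.
  exact: continuous_shifted_powR.
have mh n : measurable_fun setT (h n).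
  apply/measurable_EFinP.
  exact: (measurable_fun_point (f := fun x => (f x + n.+1%:R^-1) `^ (- q)) (proj2 (th n))).
have h0 n x : setT x -> (0 <= h n x)%E by move=> _; rewrite lee_fin powR_ge0.
have ndh x : setT x -> {homo h^~ x : a b / (a <= b)%N >-> (a <= b)%E}.
  move=> _ a b ab; rewrite lee_fin; apply: ler_negative_powR; rewrite ?fe ?(ltW q0)//.
  by rewrite lerD2l lef_pV2 ?posrE// ler_nat.
have -> : (\int[torus_measure d]_x (`|(f (Defs.point x))%:E^-1| `^ q) =
    \int[torus_measure d]_x limn (h ^~ x))%E.
  apply: eq_integral => x _; apply/esym/cvg_lim => //.
  exact: cvg_shifted_negative_powR.
rewrite (monotone_convergence _ measurableT mh h0 ndh).
apply: lime_le.
  apply: ereal_nondecreasing_is_cvgn => a b ab; apply: ge0_le_integral => // x _.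
    exact: h0.
  exact: ndh.
apply: nearW => n; rewrite /h (torus_integral_EFin (th n)) lee_fin.
by apply: fC; rewrite invr_gt0.
Qed.

Lemma integral_power_le d (f : 'rV[R]_d -> R) (p C : R) :
  torus_continuous f -> (forall x, 0 <= f x) -> 0 < p ->
  torus_integral (fun x => f x * (f x + 1) `^ p) <= C ->
  (\int[torus_measure d]_x (`|(f (Defs.point x))%:E| `^ (p + 1)) <= C%:E)%E.
Proof.
move=> tf f0 p0 fC; apply: (@le_trans _ _ (torus_integral (fun x => f x * (f x + 1) `^ p))%:E);
  last by rewrite lee_fin.
have tU : torus_continuous (fun x => f x * (f x + 1) `^ p).
  apply: torus_continuousM => //.
  apply: (torus_continuous_comp (G := fun z => (z + 1) `^ p)) => // x.
  by apply: continuous_shifted_powR; rewrite ltr_wpDl.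
rewrite -(torus_integral_EFin tU); apply: ge0_le_integral => //.
- by move=> x _; exact: poweR_ge0.
- apply: (eq_measurable_fun (fun x => ((f (Defs.point x)) `^ (p + 1))%:E)).
    by move=> x _; rewrite abse_EFin poweR_EFin ger0_norm.
  apply/measurable_EFinP; apply: (measurableT_comp (measurable_powR (p + 1))).
  exact: measurable_fun_point (proj2 tf).
- by apply/measurable_EFinP; exact: (measurable_fun_point (proj2 tU)).
- move=> x _; rewrite abse_EFin poweR_EFin lee_fin ger0_norm//.
  have := f0 (Defs.point x); set y := f (Defs.point x) => y0.
  rewrite powRD; last by rewrite gt_eqF ?ltr_wpDl ?(ltW p0).
  rewrite powRr1// mulrC ler_wpM2l//.
  by apply: ge0_ler_powR; rewrite ?nnegrE ?(ltW p0) ?addr_ge0// lerDl.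
Qed.

End Lnorm_bounds.

(** * The two estimates for the planning problem *)

Unset Implicit Arguments.

Theorem theorem1p1 (R : realType) (d : nat) (T : R)
    (V : R -> 'rV[R]_d -> R) (g : R -> R) (m0 mT : 'rV[R]_d -> R)
    (d_ge1 : (1 <= d)%N) (T_gt0 : 0 < T)
    (data : planning_data T V g m0 mT) :
  (forall p : R, 0 < p ->
     (cylinder_Linfty T (fun t => laplacian (V t)) < (2 / T ^+ 2 * p^-1)%:E)%E ->
     exists C : R, 0 < C /\
       forall u m : R -> 'rV[R]_d -> R, planning_solution T V g m0 mT u m ->
         (max_Lnorm T (p + 1)%R (fun t x => (m t x)%:E) <= C%:E)%E)
  /\
  (d = 1%N ->
   forall p : R, 2 <= p ->
     (cylinder_Linfty T (fun t => laplacian (V t)) < (2 / T ^+ 2 * p^-1)%:E)%E ->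
     (exists k0 : R, 0 < k0 /\ forall x, k0 <= m0 x /\ k0 <= mT x) ->
     exists C : R, 0 < C /\
       forall u m : R -> 'rV[R]_d -> R, planning_solution T V g m0 mT u m ->
         (* reciprocal in \bar R, where 0^-1 = +oo *)
         (max_Lnorm T (p - 1)%R (fun t x => (m t x)%:E^-1) <= C%:E)%E).
Proof.
split=> [p p0 | d1 p p2].
  move=> /(cylinder_Linfty_gap T_gt0 p0)[K [K0 VK KpT]].
  (* Chosen before any solution is introduced, from the energies of the two prescribed densities. *)
  pose A := Num.max (torus_integral (fun x => m0 x * (m0 x + 1) `^ p))
                    (torus_integral (fun x => mT x * (mT x + 1) `^ p)).
  pose C := A / (1 - K * p * T ^+ 2 / 2).
  (* The summand 1 only ensures strict positivity. *)
  exists (C `^ (p + 1)^-1 + 1); split; first by rewrite ltr_wpDl// powR_ge0.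
  move=> u m sol; apply: ge_ereal_sup => _ [t + <-]; rewrite /= in_itv /= => t0T.
  apply: (@le_trans _ _ (C `^ (p + 1)^-1)%:E); last by rewrite lee_fin lerDl.
  apply: torus_Lnorm_le; first by rewrite addr_gt0.
  apply: integral_power_le => //.
  - exact: (solution_torus_continuous data sol t0T).
  - by move=> x; exact: (solution_ge0 sol x t0T).
  apply: (power_energy_bound T_gt0 data sol K0 VK KpT p0 _ _ t0T).
  - by rewrite le_max lexx.
  - by rewrite le_max lexx orbT.
have p0 : 0 < p by rewrite (lt_le_trans _ p2).
have p1 : 1 <= p by rewrite (le_trans _ p2)// ler1n.
have q1 : 1 <= p - 1 by rewrite lerBrDr.
have q0 : 0 <= p - 1 by rewrite subr_ge0.
subst d => /(cylinder_Linfty_gap T_gt0 p0)[K [K0 VK KpT]] [k0 [k0_gt0 mk0]].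
pose C := k0 `^ (1 - p) / (1 - K * p * T ^+ 2 / 2).
exists (C `^ (p - 1)^-1 + 1); split; first by rewrite ltr_wpDl// powR_ge0.
move=> u m sol; apply: ge_ereal_sup => _ [t + <-]; rewrite /= in_itv /= => t0T.
apply: (@le_trans _ _ (C `^ (p - 1)^-1)%:E); last by rewrite lee_fin lerDl.
apply: torus_Lnorm_le; first exact: lt_le_trans q1.
apply: integral_inverse_power_le => //.
- exact: (solution_torus_continuous data sol t0T).
- by move=> x; exact: (solution_ge0 sol x t0T).
move=> e e0; rewrite opprB.
(* The exponent 1 - p is negative and the shift raises the base above k0, so the end energies are
   bounded uniformly in [e]. *)
have initial_energy (f : 'rV[R]_1 -> R) : smooth_torus f -> (forall x, k0 <= f x) ->
    torus_integral (fun x => (f x + e) `^ (1 - p)) <= k0 `^ (1 - p).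
  move=> [pf sf] fk0; have fe x : k0 <= f x + e by rewrite ler_wpDr// ltW.
  rewrite -[leRHS](@torus_integral_cst R 1).
  apply: le_torus_integral.
  - apply: (torus_continuous_comp (G := fun z => (z + e) `^ (1 - p))).
      by split=> //; exact: smooth_continuous.
    by move=> x; apply: continuous_shifted_powR; exact: lt_le_trans (fe x).
  - exact: torus_continuous_cst.
  - by move=> x; rewrite -opprB; exact: ler_negative_powR.
have [_ _ [sm0 _ _] [smT _ _]] := data.
apply: (negative_power_energy_bound T_gt0 data sol K0 VK KpT p1 e0 _ _ t0T).
- by apply: initial_energy => // x; case: (mk0 x).
- by apply: initial_energy => // x; case: (mk0 x).
Qed.
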